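(* Let $G$ be a connected bridgeless graph and let $D$ be a dominating set of $G$ with $|D|=\gamma$. Then $\overrightarrow{sdiam}(G)\le 7\gamma-1$. Moreover, this bound is sharp: for every positive integer $\gamma$ there is a connected bridgeless graph $G$ with domination number $\gamma$ and $\overrightarrow{sdiam}(G)=7\gamma-1$.
   Context: Graphs are finite, simple, undirected and connected. A graph is bridgeless if it has no edge whose removal disconnects it. A dominating set $D$ of $G$ is a vertex set such that every vertex not in $D$ is adjacent to some vertex of $D$; the domination number is the minimum size of a dominating set. An orientation $\overrightarrow{G}$ of $G$ assigns a direction to each edge; it is strong if for all vertices $u,v$ there is a directed path from $u$ to $v$. For a strong orientation $\overrightarrow{G}$ and vertices $u,v$, the strong distance $sd(u,v)$ is the minimum number of arcs of a strongly connected subdigraph of $\overrightarrow{G}$ containing both $u$ and $v$, and $sdiam(\overrightarrow{G})=\max_{u,v}sd(u,v)$. The oriented strong diameter $\overrightarrow{sdiam}(G)$ of a bridgeless graph $G$ is the minimum of $sdiam(\overrightarrow{G})$ over all strong orientations $\overrightarrow{G}$ of $G$. *)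

(* Defs.v *)
From mathcomp Require Import all_boot.

Set Implicit Arguments.
Unset Strict Implicit.
Unset Printing Implicit Defensive.

Record sgraph := SGraph {
  vertex :> finType;
  adj : rel vertex;
  adj_sym : symmetric adj;
  adj_irrefl : irreflexive adj
}.

Definition connected_rel (T : finType) (e : rel T) : Prop :=
  0 < #|T| /\ forall x y : T, connect e x y.

Definition connected (G : sgraph) : Prop := connected_rel (@adj G).

Definition remove_edge (G : sgraph) (x y : G) : rel G :=
  [rel u v | adj u v && ([set u; v] != [set x; y])].

Definition bridge (G : sgraph) (x y : G) : Prop :=
  adj x y /\ ~ connected_rel (remove_edge x y).

Definition bridgeless (G : sgraph) : Prop := forall x y : G, ~ bridge x y.

Definition dominating (G : sgraph) (D : {set G}) : bool :=
  [forall x, (x \notin D) ==> [exists y in D, adj x y]].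

Definition domination_number (G : sgraph) : nat :=
  #|[arg min_(D < [set: G] | dominating D) #|D|]|.

(* A digraph with vertex type T is given by its set of arcs; (x, y) is the arc
   from x to y. *)
Section Digraph.

Variable T : finType.
Implicit Types (A F : {set T * T}) (S : {set T}) (u v : T).

Definition arc_rel A : rel T := [rel x y | (x, y) \in A].

Definition strong A : Prop := forall u v, connect (arc_rel A) u v.

(* H = (S, F): the vertex set and the arc set of the subdigraph. *)
Definition subdigraph A (H : {set T} * {set T * T}) : bool :=
  (H.2 \subset A) && [forall a in H.2, (a.1 \in H.1) && (a.2 \in H.1)].

Definition strong_subdigraph A (H : {set T} * {set T * T}) : bool :=
  subdigraph A H &&
  [forall x in H.1, forall y in H.1, connect (arc_rel H.2) x y].

(* The seed ([set: T], A) of the arg min is admissible when A is strong; see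
   sd_min. *)
Definition sd A u v : nat :=
  #|[arg min_(H < ([set: T], A) |
       [&& strong_subdigraph A H, u \in H.1 & v \in H.1]) #|H.2| ].2|.

Definition sdiam A : nat := \max_(u : T) \max_(v : T) sd A u v.

Lemma sd_min A u v : strong A ->
  (exists H, [/\ strong_subdigraph A H, u \in H.1, v \in H.1
                 & #|H.2| = sd A u v]) /\
  (forall H, strong_subdigraph A H -> u \in H.1 -> v \in H.1 ->
     sd A u v <= #|H.2|).
Proof.
move=> sA; rewrite /sd; case: arg_minnP => [|H /and3P[sH uH vH] minH].
  rewrite !inE /strong_subdigraph /subdigraph /= subxx !andbT /=.
  apply/andP; split; first by apply/forall_inP=> a _; rewrite !inE.
  by apply/forall_inP=> x _; apply/forall_inP=> y _; apply: sA.
by split=> [|K sK uK vK]; [exists H | apply: minH; rewrite sK uK].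
Qed.

End Digraph.

Definition orientation (G : sgraph) (A : {set G * G}) : Prop :=
  (forall x y, (x, y) \in A -> adj x y) /\
  (forall x y, adj x y -> ((x, y) \in A) (+) ((y, x) \in A)).

(* k is the minimum of sdiam over the strong orientations of G. A relation
   rather than a function, so that it includes the existence of a strong
   orientation. *)
Definition oriented_sdiam (G : sgraph) (k : nat) : Prop :=
  (exists A : {set G * G}, [/\ orientation A, strong A & sdiam A = k]) /\
  (forall A : {set G * G}, orientation A -> strong A -> k <= sdiam A).

(* Main.v *)
Require Import Defs.
From mathcomp Require Import all_boot.
From mathcomp Require Import zify.

(** The subgraph is grown from a single vertex of [D] by attaching ears, each
    oriented as a directed path, so that it stays strong.  If it spans [S], has
    [n] arcs, contains [a] vertices of [D] and has [u] vertices of [D] at distance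
    at most 1, the invariant is [n + 7 <= 4 a + 3 u].  While [a < u], a shortest
    ear through a vertex of [D] adjacent to [S] keeps the invariant, because a
    vertex of [D] dominates at most three, nearby, vertices of a shortest path.
    When [a = u] one looks for a bounded number of ears after which [u] has grown
    and the invariant holds again; the vertices of an ear not dominated by [S]
    bring in new elements of [D], and the few short ears that do not pay for
    themselves are rerouted through such an element.  At the end [D] is contained
    in [S], hence [n <= 7 (#|D| - 1)].

    Every vertex outside [S] is then placed on an ear with at most three arcs, so
    that two vertices lie in a strong subdigraph with at most [n + 6] arcs.

    For sharpness take a chain of triangles and 4-cycles glued at cut vertices
    whose vertices can be numbered so that every initial segment is bounded by
    exactly two edges: a strong subdigraph containing the first and the last
    vertex needs an arc in each direction across each such cut, hence all edges. *)

Set Implicit Arguments.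
Unset Strict Implicit.
Unset Printing Implicit Defensive.

(* [lia] is very slow when the context holds non-arithmetic facts. *)
Ltac arith :=
  repeat match goal with
  | H : ?P |- _ => lazymatch P with
    | is_true (leq _ _) => fail
    | is_true (andb (leq _ _) (leq _ _)) => fail
    | @eq nat _ _ => fail
    | not (@eq _ _ _) => fail
    | @eq _ _ _ -> False => fail
    | _ => clear H
    end
  end; lia.

(** * Strong oriented subgraphs grown by ears *)

Section Ears.

Variable G : sgraph.
Implicit Types (S : {set G}) (F : {set G * G}) (s t x y z : G) (p q : seq G).

(** [F] need not orient every edge inside [S]; the remaining edges receive a direction only after
    the growth has ended. *)
Definition oriented_strong S F : Prop :=
  [/\ forall x y, (x, y) \in F -> [/\ adj x y, x \in S & y \in S],
      forall x y, (x, y) \in F -> (y, x) \notin F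
    & forall x y, x \in S -> y \in S -> connect (arc_rel F) x y].

Definition strongly_spanned S (n : nat) : Prop :=
  exists2 F, oriented_strong S F & #|F| <= n.

(** Closed ears with [s = t] are allowed, except with a single inner vertex, where one edge would be
    used in both directions. Every arc of an ear has an end outside [S]. *)
Definition ear S s p t : bool :=
  [&& s \in S, t \in S, path (@adj G) s (rcons p t), uniq p,
      all [pred x | x \notin S] p, 0 < size p & (size p == 1) ==> (s != t)].

Lemma strongly_spanned_set1 x : strongly_spanned [set x] 0.
Proof.
exists set0; last by rewrite cards0.
split=> [u v|u v|u v]; rewrite ?inE // => /eqP-> /eqP->; exact: connect0.
Qed.

(** [zip (belast x q) q] lists the arcs of the walk from [x] along [q]; arc sets of ears are written
    this way below. *)
Lemma path_mem_zip (T : eqType) (x : T) (q : seq T) :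
  path (fun u v => (u, v) \in zip (belast x q) q) x q.
Proof.
elim: q x => //= y q IHq x; rewrite mem_head /=.
by apply: sub_path (IHq y) => u v uv; rewrite inE uv orbT.
Qed.

Lemma connect_path_mem (T : finType) (e : rel T) (x z : T) (q : seq T) :
  path e x q -> z \in q -> connect e x z /\ connect e z (last x q).
Proof.
move=> exq /splitPr qE; case: qE exq => q1 q2.
rewrite cat_path /= last_cat /= => /and3P[e1 ez e2]; split.
  by apply/connectP; exists (rcons q1 z); rewrite ?rcons_path ?e1 ?last_rcons.
by apply/connectP; exists q2.
Qed.

Lemma connect_crossing (T : finType) (e : rel T) (X : {pred T}) (x y : T) :
  connect e x y -> x \in X -> y \notin X ->
  exists a b, [/\ a \in X, b \notin X & e a b].
Proof.
case/connectP=> q; elim: q x => [|z q IHq] x /= => [_ -> -> //|].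
case/andP=> xz zq yE xX yX; case: (boolP (z \in X)) => zX; first exact: IHq zX yX.
by exists x, z.
Qed.

Lemma mem_zip_nth (T : eqType) (x0 : T) (s t : seq T) a :
  size s = size t -> a \in zip s t ->
  exists2 i, i < size s & a = (nth x0 s i, nth x0 t i).
Proof.
move=> st /(nthP (x0, x0))[i]; rewrite size_zip -st minnn => lti <-.
by exists i; rewrite ?nth_zip.
Qed.

(* The ear is traversed from [s] to [t], which keeps the subgraph strong. *)
Lemma strongly_spanned_ear S n s p t :
  strongly_spanned S n -> ear S s p t ->
  strongly_spanned (S :|: [set x in p]) (n + (size p).+1).
Proof.
case=> F [Fadj Fanti Fstr] Fn /and5P[sS tS pth up /and3P[pS p0 p1]].
pose q := rcons p t; pose E := [set a in zip (belast s q) q].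
have sq : size (belast s q) = size q by rewrite size_belast.
have qE : belast s q = s :: p by rewrite /q belast_rcons.
have pnS i : i < size p -> nth s p i \notin S.
  by move=> lti; apply: (allP pS); apply: mem_nth.
have inE' x y : (x, y) \in E -> exists i, [/\ i <= size p,
    x = nth s (s :: p) i & y = nth s q i].
  rewrite inE => /(mem_zip_nth s sq)[i]; rewrite qE /= ltnS => lti [-> ->].
  by exists i.
have nthq i : nth s q i = if i < size p then nth s p i else
    if i == size p then t else s by rewrite nth_rcons.
have EnS x y : (x, y) \in E -> ~ (x \in S /\ y \in S).
  case/inE'=> -[|i] [lei -> ->] /= [aS bS].
    by move: bS; rewrite nthq p0 (negPf (pnS _ _)).
  by move: aS; rewrite (negPf (pnS _ _)).
(* Opposite arcs would make two positions of the simple sequence [p] collide, apart from the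
   one-vertex ear with [s = t], which [p1] excludes. *)
have Eanti x y : (x, y) \in E -> (y, x) \notin E.
  case/inE'=> i [lei -> ->]; apply/negP=> /inE'[j [lej]].
  case: i lei => [|i] lei /=.
    rewrite nthq p0; case: j lej => [|j] lej /=.
      by move=> E0; move: (pnS _ p0); rewrite E0 sS.
    move=> /eqP; rewrite nth_uniq // => /eqP E0; subst j.
    rewrite nthq; case: ltnP => [l2 E0|l2].
      by move: (pnS _ l2); rewrite -E0 sS.
    have -> : 1 == size p by arith.
    move=> E0; have s1 : size p = 1 by arith.
    by move: p1; rewrite s1 -E0 eqxx implyTb eqxx.
  rewrite (nthq j) => E1.
  case: ltnP => [ltj /eqP|gej].
    rewrite nth_uniq // => /eqP E0; subst j.
    move: E1; rewrite nthq; case: ltnP => [l2|l2].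
      case: i lei lej ltj l2 => [|i] lei lej ltj l2 /=.
        by move=> E0; move: (pnS _ l2); rewrite E0 sS.
      by move=> /eqP; rewrite nth_uniq //; arith.
    have -> : i.+1 == size p by arith.
    case: i lei lej ltj l2 => [|i] lei lej ltj l2 /=.
      move=> E0; have s1 : size p = 1 by arith.
      by move: p1; rewrite s1 E0 eqxx implyTb eqxx.
    by move=> E0; move: (pnS i ltac:(arith)); rewrite -E0 tS.
  have -> : j == size p by arith.
  by move=> E0; move: (pnS i ltac:(arith)); rewrite E0 tS.
have pq x : x \in q -> x \in S :|: [set x in p].
  by rewrite mem_rcons !inE => /orP[/eqP->|->]; rewrite ?tS ?orbT.
have subF : subrel (arc_rel F) (connect (arc_rel (F :|: E))).
  by move=> x y xy; apply: connect1; rewrite /arc_rel /= inE [_ \in F]xy.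
have pthE : path (arc_rel (F :|: E)) s q.
  apply: sub_path (path_mem_zip s q) => x y xy.
  by rewrite /arc_rel /= !inE xy orbT.
exists (F :|: E).
  split=> [x y|x y|x y].
  - rewrite inE => /orP[/Fadj[-> xS yS]|xyE]; first by rewrite !inE xS yS.
    have xyq : (x, y) \in zip (belast s q) q by move: xyE; rewrite inE.
    split.
    + move: pth xyq; rewrite -/q; clear -q; elim: q s => //= w q IHq s.
      case/andP=> sw wq; rewrite inE => /orP[/eqP[-> ->] //|].
      exact: IHq.
    + have : x \in s :: p.
        rewrite -qE; case/(mem_zip_nth s sq): xyq => i lti [-> _].
        exact: mem_nth.
      by rewrite !inE => /orP[/eqP->|->]; rewrite ?sS ?orbT.
    + apply: pq; case/(mem_zip_nth s sq): xyq => i lti [_ ->].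
      by apply: mem_nth; rewrite -sq.
  - rewrite !(in_setU) => /orP[xyF|xyE]; rewrite negb_or.
      rewrite Fanti //=; apply/negP=> /EnS; case.
      by have [_ ? ?] := Fadj _ _ xyF.
    rewrite Eanti // andbT; apply/negP=> yxF; case: (EnS _ _ xyE).
    by have [_ ? ?] := Fadj _ _ yxF.
  (* Each vertex is reached from [s] and reaches [t]; the old arcs lead from [t] back to [s]. *)
  - have toS u : u \in S :|: [set x in p] -> connect (arc_rel (F :|: E)) u t
      /\ connect (arc_rel (F :|: E)) s u.
      have Fc a b : a \in S -> b \in S -> connect (arc_rel (F :|: E)) a b.
        move=> aS bS; exact: (connect_sub subF (Fstr _ _ aS bS)).
      rewrite !inE => /orP[uS|up']; first by split; apply: Fc.
      have uq : u \in q by rewrite mem_rcons inE up' orbT.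
      have [c1 c2] := connect_path_mem pthE uq.
      by split=> //; move: c2; rewrite last_rcons.
    have ts : connect (arc_rel (F :|: E)) t s.
      exact: (connect_sub subF (Fstr _ _ tS sS)).
    move=> /toS[xt _] /toS[_ sy]; apply: connect_trans xt _.
    exact: connect_trans ts sy.
apply: leq_trans (leq_card_setU F E) _; apply: leq_add => //.
rewrite cardsE; apply: leq_trans (card_size _) _.
by rewrite size_zip sq minnn size_rcons.
Qed.

End Ears.

(** * Shortest ears and what their vertices can see *)

Section GeodesicEars.

Variable G : sgraph.
Implicit Types (B : {set G}) (s t x y z : G) (p q : seq G).

(** What is kept of shortness: before its last vertex the ear sees [B] only through its initial
    edge, it has no chords, and the neighbours on it of an outside vertex are at most two steps
    apart. *)
Definition geodesic_ear B s p t : Prop :=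
  [/\ ear B s p t,
      forall i w, i.+1 < size p -> w \in B -> adj (nth s p i) w ->
        i = 0 /\ w = s,
      forall i j, i < size p -> j < size p ->
        adj (nth s p i) (nth s p j) -> j <= i.+1
    & forall i j y, i < size p -> j < size p -> y \notin B ->
        adj y (nth s p i) -> adj y (nth s p j) -> j <= i.+2].

Lemma remove_edgeE s x u v : adj u v -> (u = x -> v <> s) -> (u = s -> v <> x) ->
  remove_edge s x u v.
Proof.
move=> uv H1 H2; rewrite /remove_edge /= uv /=.
apply/eqP=> /setP E; have := E u; rewrite !inE eqxx /=.
have vE := E v; move: vE; rewrite !inE eqxx orbT /= => /esym vE /esym uE.
have nuv : u != v by apply: contraTneq uv => ->; rewrite adj_irrefl.
case/orP: uE => /eqP uE; case/orP: vE => /eqP vE.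
- by rewrite uE vE eqxx in nuv.
- exact: H2 uE vE.
- exact: H1 uE vE.
- by rewrite uE vE eqxx in nuv.
Qed.

(** Tuples make the existence of a path of given length decidable, so a least length exists. *)
Lemma shortest_path_to (r : rel G) (B : {set G}) x y : connect r x y -> y \in B ->
  exists q : seq G, [/\ path r x q, uniq (x :: q), last x q \in B
    & forall q2 : seq G, path r x q2 -> last x q2 \in B -> size q <= size q2].
Proof.
move=> cxy yB; pose P n := [exists q : n.-tuple G, path r x q && (last x q \in B)].
have [n Pn] : exists n, P n.
  case/connectP: cxy => q rq yE; exists (size q); apply/existsP.
  by exists (in_tuple q); rewrite /= rq -yE yB.
case: (ex_minnP (ex_intro _ n Pn)) => {n Pn} n /existsP[q /andP[rq qB]] minn.
case/shortenP: rq qB => q' rq' uq' sub qB; exists q'; split=> // q2 r2 B2.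
apply: (@leq_trans n).
  by rewrite -(size_tuple q); apply: uniq_leq_size => //; case/andP: uq'.
by apply: minn; apply/existsP; exists (in_tuple q2); rewrite /= r2.
Qed.

(* A shortest path from [x] back to [B] after deleting the edge [sx]. *)
Lemma geodesic_ear_exists B s x :
  connected G -> bridgeless G -> s \in B -> x \notin B -> adj s x ->
  exists p t, geodesic_ear B s (x :: p) t.
Proof.
move=> [G0 _] nob sB xB sx; set r := remove_edge s x.
have cxs : connect r x s.
  by apply: contraT => /negP nc; case: (nob s x); split=> // -[_ /(_ x s)].
have [q [rq uq qB min]] := shortest_path_to cxs sB.
have [p [t qE]] : exists (p : seq G) t, q = rcons p t.
  case/lastP: q rq uq qB min => [|p t] *; last by exists p, t.
  by case/negP: xB.
move: rq uq qB min; rewrite {q}qE last_rcons size_rcons => rq up tB min.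
(* An earlier visit to [B] would end a shorter path. *)
have nxt i : i < size p -> nth s p i \notin B.
  move=> lti; apply/negP=> pB; have := min (take i.+1 p).
  rewrite size_take; case: (ltnP i.+1) => lt2; last first.
    have E : i.+1 = size p by apply/eqP; rewrite eqn_leq lti.
    move: rq; rewrite rcons_path => /andP[rq _].
    rewrite E take_size => /(_ rq); rewrite (last_nth s) -E /= => /(_ pB).
    by rewrite ltnn.
  have := rq; rewrite -{1}(cat_take_drop i.+1 p) rcons_cat cat_path.
  case/andP=> r1 _ /(_ r1); rewrite (last_nth s) size_take lt2 /= nth_take //.
  by move=> /(_ pB); arith.
have nB i : i <= size p -> nth s (x :: p) i \notin B.
  by case: i => //= i; apply: nxt.
have radj : subrel r (@adj G) by move=> u v /andP[].
(* Replacing a stretch of the path by another walk cannot shorten it. *)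
have walk i j w : i <= size p -> j <= size p ->
    path r (nth s (x :: p) i) w -> last (nth s (x :: p) i) w = nth s (x :: p) j ->
    j <= i + size w.
  move=> li lj rw lw; have := min (take i p ++ w ++ drop j (rcons p t)).
  rewrite !size_cat size_drop size_rcons size_takel // => H.
  have lt : last x (take i p) = nth s (x :: p) i.
    rewrite (last_nth s) size_takel //; case: (i) li => //= k lk.
    by rewrite nth_take.
  have r1 : path r x (take i p).
    move: rq; rewrite -{1}(cat_take_drop i p) rcons_cat cat_path.
    by case/andP.
  have r2 : path r (nth s (x :: p) j) (drop j (rcons p t)).
    have lj' : j < size (x :: rcons p t) by rewrite /= size_rcons ltnS ltnW.
    case: (j) lj => [|k] lk /=; first by rewrite drop0.
    move: rq; rewrite -{1}(cat_take_drop k.+1 (rcons p t)) cat_path.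
    rewrite (last_nth s) size_takel ?size_rcons ?ltnS 1?ltnW //= nth_take //.
    by rewrite nth_rcons lk => /andP[].
  have : size (rcons p t) <= i + (size w + ((size p).+1 - j)).
    rewrite size_rcons; apply: H.
      by rewrite !cat_path r1 lt rw lw r2.
    rewrite !last_cat lt lw drop_rcons // last_rcons //.
  rewrite size_rcons; arith.
have rB u v : u \notin B -> v \notin B -> adj u v -> r u v.
  move=> uB vB uv; apply: remove_edgeE => // [_ E|E _].
    by rewrite E sB in vB.
  by rewrite E sB in uB.
exists p, t; split.
- apply/and5P; split=> //.
  + by rewrite /= sx; apply: sub_path radj _ _ rq.
  + by move: up; rewrite -rcons_cons rcons_uniq => /andP[].
  + apply/and3P; split=> //.
      by apply/(all_nthP s) => i /=; rewrite ltnS; apply: nB.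
    (* With [x] as only inner vertex and [t = s], the path would use the deleted edge. *)
    rewrite /= eqSS size_eq0; apply/implyP=> /eqP p0; move: rq; rewrite p0 /= andbT.
    by apply: contraTneq => <-; rewrite /r /remove_edge /= setUC eqxx andbF.
- move=> i w /= li wB iw.
  case: (boolP ((i == 0) && (w == s))) => [/andP[/eqP-> /eqP->] //|/negP nE].
  exfalso.
  have riw : r (nth s (x :: p) i) w.
    apply: remove_edgeE => // [iE wE|iE _]; last first.
      by move: (nB i ltac:(arith)); rewrite iE sB.
    apply: nE; rewrite wE eqxx andbT.
    have up' : uniq (x :: p).
      by move: up; rewrite -rcons_cons rcons_uniq => /andP[].
    by rewrite -(nth_uniq s _ _ up') ?iE //=; arith.
  (* Leaving the path at [i] for [w] gives a shorter competitor, since [i] is not the last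
     position. *)
  have := min (rcons (take i p) w); rewrite size_rcons size_takel; last arith.
  rewrite last_rcons rcons_path; move=> /(_ _ wB) H.
  suff : size p < i.+1 by arith.
  apply: H; apply/andP; split.
    move: rq; rewrite -{1}(cat_take_drop i p) rcons_cat cat_path.
    by case/andP.
  rewrite (last_nth s) size_takel; last arith.
  by case: (i) li riw {iw nE} => //= k lk; rewrite nth_take.
- move=> i j /=; rewrite !ltnS => li lj ij; rewrite -addn1.
  by apply: (walk i j [:: nth s (x :: p) j]) => //=; rewrite rB // nB.
- move=> i j y /=; rewrite !ltnS => li lj yB yi yj; rewrite -addn2.
  apply: (walk i j [:: y; nth s (x :: p) j]) => //=.
  by rewrite adj_sym in yi; rewrite !rB ?nB.
Qed.

(** Equality is allowed because a dominator may itself lie on the ear. *)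
Lemma geodesic_ear_window B s p t i j y :
  geodesic_ear B s p t -> i < size p -> j < size p -> y \notin B ->
  y = nth s p i \/ adj y (nth s p i) -> y = nth s p j \/ adj y (nth s p j) ->
  j <= i.+2.
Proof.
case=> earp _ adjp win li lj yB.
have up : uniq p by case/and5P: earp.
case=> [yi|yi] [yj|yj]; last exact: win yi yj.
- by have /eqP := etrans (esym yi) yj; rewrite nth_uniq // => /eqP->; arith.
- by rewrite yi in yj; have := adjp _ _ li lj yj; arith.
- by rewrite yj adj_sym in yi; have := adjp _ _ li lj yi; arith.
Qed.

End GeodesicEars.

(** * Growing the subgraph towards a dominating set *)

(** The map taking [i] to [(f i, i %% g)] is injective, since indices with equal image under [f]
    differ by less than [g]. *)
Lemma window_count (T : finType) (f : nat -> T) (Y : {set T}) lo hi g :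
  0 < g -> (forall i, lo <= i < hi -> f i \in Y) ->
  (forall i j, lo <= i < hi -> lo <= j < hi -> f i = f j -> j < i + g) ->
  hi - lo <= g * #|Y|.
Proof.
move=> g0 fY win; pose h i := (f i, i %% g).
have memi i : i \in iota lo (hi - lo) -> lo <= i < hi.
  by rewrite mem_iota; arith.
have -> : hi - lo = size (map h (iota lo (hi - lo))).
  by rewrite size_map size_iota.
have -> : g * #|Y| = size [seq (y, r) | y <- enum Y, r <- iota 0 g].
  by rewrite size_allpairs size_iota -cardE mulnC.
apply: uniq_leq_size => [|_ /mapP[i /memi ir ->]].
  rewrite map_inj_in_uniq ?iota_uniq // => i j /memi ir /memi jr [fij mij].
  have := win _ _ ir jr fij; have := win _ _ jr ir (esym fij).
  have := divn_eq i g; have := divn_eq j g; rewrite mij.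
  set a := _ %/ g; set b := _ %/ g; set m := _ %% g.
  move=> jE iE; rewrite jE iE => lt1 lt2; congr (_ * g + _).
  clear -lt1 lt2 g0; nia.
by apply/allpairsP; exists (f i, i %% g); rewrite mem_enum mem_iota ltn_pmod ?fY.
Qed.

Section Growth.

Variables (G : sgraph) (D : {set G}).
Hypotheses (connG : connected G) (noG : bridgeless G) (domD : dominating D).
Implicit Types (S K : {set G}) (s t x y z : G) (p : seq G).

Definition nbhd S : {set G} := [set x | (x \in S) || [exists s in S, adj s x]].
(** [cov] and [near] are the numbers a and u of the invariant n + 7 <= 4 a + 3 u. *)
Definition cov S : nat := #|D :&: S|.
Definition near S : nat := #|D :&: nbhd S|.

(** The default [z] is never reached when [D] is dominating. A member of [D] may be assigned a
    neighbour in [D] instead of itself. *)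
Definition dominator z : G :=
  odflt z [pick y in D | (y == z) || adj y z].

Lemma dominatorP z :
  dominator z \in D /\ (dominator z = z \/ adj (dominator z) z).
Proof.
rewrite /dominator; case: pickP => [y /andP[yD /orP[/eqP<-|yz]]|none] /=.
- by split; [exact: yD | left].
- by split; [exact: yD | right].
- have zD : z \notin D by move: (none z); rewrite eqxx andbT => ->.
  have /implyP/(_ zD)/exists_inP[y yD zy] := forallP domD z.
  by move: (none y); rewrite /= yD adj_sym zy orbT.
Qed.

Lemma sub_nbhd S : S \subset nbhd S.
Proof. by apply/subsetP=> x xS; rewrite inE xS. Qed.

Lemma adj_nbhd S x y : x \in S -> adj x y -> y \in nbhd S.
Proof. by move=> xS xy; rewrite inE; apply/orP; right; apply/exists_inP; exists x. Qed.

Lemma nbhdS S K : S \subset K -> nbhd S \subset nbhd K.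
Proof.
move=> /subsetP sSK; apply/subsetP=> x; rewrite inE.
case/orP=> [/sSK/(subsetP (sub_nbhd K)) //|/exists_inP[s sS sx]].
exact: adj_nbhd (sSK _ sS) sx.
Qed.

Lemma dominator_nbhd S z : z \in S -> dominator z \in nbhd S.
Proof.
move=> zS; case: (dominatorP z) => _ [->|]; first exact: (subsetP (sub_nbhd S)).
by rewrite adj_sym; apply: adj_nbhd.
Qed.

Lemma nearD S K : S \subset K ->
  near S + #|(D :&: nbhd K) :\: nbhd S| = near K.
Proof.
move=> sSK; rewrite /near -(cardsID (nbhd S) (D :&: nbhd K)) -setIA.
by rewrite (setIidPr (nbhdS sSK)).
Qed.

(** The values of [f] are vertices of [D] first seen by [K], each serving at most [g] positions. *)
Lemma window_near S K (f : nat -> G) lo hi g : S \subset K -> 0 < g ->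
  (forall i, lo <= i < hi -> [/\ f i \in D, f i \in nbhd K & f i \notin nbhd S]) ->
  (forall i j, lo <= i < hi -> lo <= j < hi -> f i = f j -> j < i + g) ->
  hi - lo + g * near S <= g * near K.
Proof.
move=> sSK g0 fP win; rewrite -(nearD sSK) mulnDr addnC leq_add2l.
apply: window_count win => // i /fP[fD fK fS].
by rewrite !inE in fK fS *; rewrite fS fD fK.
Qed.

Lemma cov_lt S K z : S \subset K -> z \in D -> z \in K -> z \notin S ->
  cov S < cov K.
Proof.
move=> sSK zD zK zS; apply: proper_card; apply/properP; split.
  exact: setIS.
by exists z; rewrite !inE zD ?zK ?(negPf zS).
Qed.

Lemma near_lt S K z : S \subset K -> z \in D -> z \in nbhd K -> z \notin nbhd S ->
  near S < near K.
Proof.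
move=> sSK zD zK zS; apply: proper_card; apply/properP; split.
  by apply: setIS; apply: nbhdS.
by exists z; rewrite in_setI zD ?zK ?(negPf zS).
Qed.

Lemma cov_le S K : S \subset K -> cov S <= cov K.
Proof. by move=> sSK; apply: subset_leq_card; apply: setIS. Qed.

(* An arc budget of 4 for each vertex of [D] absorbed and 3 for each vertex of
   [D] first seen at distance at most 1. *)
Definition progress S n : Prop :=
  exists K m, [/\ strongly_spanned K m, near S < near K, cov S <= cov K &
    m + (4 * cov S + 3 * near S) <= n + (4 * cov K + 3 * near K)].

(** * Ears rerouted through a vertex of the dominating set *)

Lemma ear_notin K s p t z : ear K s p t -> z \in p -> z \notin K.
Proof. by case/and5P=> _ _ _ _ /and3P[/allP pK _ _] /pK. Qed.

(** The [g - 1] vertices strictly between positions [i] and [i + g] give way to [y]: the length is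
    unchanged for [g = 2] and grows by one for [g = 1]. *)
Lemma reroute K s p t y i g : ear K s p t -> y \notin K -> y \notin p ->
  0 < g -> i + g < size p -> adj y (nth s p i) -> adj y (nth s p (i + g)) ->
  ear K s (take i.+1 p ++ y :: drop (i + g) p) t.
Proof.
move=> /and5P[sK tK pth up /and3P[pK _ _]] yK yp g0 ig yi yj.
have li : i < size p by arith.
have dropE : drop (i + g) p = nth s p (i + g) :: drop (i + g).+1 p.
  exact: drop_nth.
apply/and5P; split=> //.
- rewrite rcons_cat rcons_cons cat_path /= dropE /= yj.
  move: pth; rewrite -{1}(cat_take_drop i.+1 p) rcons_cat cat_path.
  case/andP=> -> rest; rewrite (last_nth s) size_takel //= nth_take //.
  rewrite (adj_sym (nth s p i)) yi /=; move: rest.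
  rewrite -(cat_take_drop (g.-1) (drop i.+1 p)) drop_drop.
  have -> : g.-1 + i.+1 = i + g by arith.
  by rewrite dropE rcons_cat cat_path /= => /and3P[].
- rewrite cat_uniq take_uniq //= drop_uniq // andbT negb_or.
  have yd m : y \notin drop m p by apply: contra yp; apply: mem_drop.
  have yt m : y \notin take m p by apply: contra yp; apply: mem_take.
  rewrite yd yt /= andbT; apply/hasPn=> z zd; apply/negP=> zt.
  move: up; rewrite -(cat_take_drop i.+1 p) cat_uniq => /and3P[_ /hasPn H _].
  suff /H : z \in drop i.+1 p by rewrite /= zt.
  move: zd.
  have -> : i + g = g.-1 + i.+1 by arith.
  by rewrite -drop_drop; apply: mem_drop.
- apply/and3P; split.
  + rewrite all_cat /= yK /=; apply/andP; split; apply/allP=> z.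
      by move/mem_take; apply: (allP pK).
    by move/mem_drop; apply: (allP pK).
  + by rewrite size_cat /= addnS.
  + by rewrite size_cat size_takel //= size_drop; apply/implyP=> /eqP; arith.
Qed.

Lemma mem_reroute s p y i g j : j < size p -> i < size p ->
  j <= i \/ i + g <= j -> nth s p j \in take i.+1 p ++ y :: drop (i + g) p.
Proof.
move=> lj li [ji|ij]; rewrite mem_cat inE; apply/orP.
  left; rewrite -(nth_take _ (n0 := i.+1)) // mem_nth // size_takel //.
right; rewrite -(subnKC ij) -nth_drop mem_nth ?orbT // size_drop.
by rewrite ltn_sub2r // (leq_ltn_trans ij).
Qed.

(** Here [k0] bounds the arcs spent in passing from [S] to [K]. The positions in the range pay for
    themselves through new dominators, each serving at most three; the missing 4 comes from
    absorbing a vertex of [D]. If none lies on the ear, it is rerouted through one adjacent to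
    positions at distance 2, or else 1. Failing both, the dominators are distinct, which suffices
    for two or more positions. *)
Lemma long_ear S n K k0 s p t lo hi :
  strongly_spanned K (n + k0) -> S \subset K -> D :&: nbhd K \subset S ->
  ear K s p t -> lo < hi <= size p ->
  (forall i, lo <= i < hi -> dominator (nth s p i) \notin S) ->
  (forall i j y, i < size p -> j < size p -> y \in D -> y \notin K ->
     y = nth s p i \/ adj y (nth s p i) ->
     y = nth s p j \/ adj y (nth s p j) -> j <= i.+2) ->
  k0 + (size p).+1 <= hi - lo + 4 ->
  progress S n \/ hi = lo.+1 /\ {in p, forall z, z \notin D}.
Proof.
move=> spK sSK DK earp /andP[lohi hip] fS win cost.
pose f i := dominator (nth s p i).
have memp i : i < size p -> nth s p i \in p by move=> ?; apply: mem_nth.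
have fD i : f i \in D by case: (dominatorP (nth s p i)).
have fcl i : f i = nth s p i \/ adj (f i) (nth s p i).
  by case: (dominatorP (nth s p i)).
have DnK y : y \in D -> y \notin S -> y \notin nbhd K.
  by move=> yD; apply: contra => yK; apply: (subsetP DK); rewrite inE yD.
have DnS y : y \in D -> y \notin S -> y \notin nbhd S.
  by move=> yD yS; apply: contra (DnK _ yD yS); apply: (subsetP (nbhdS sSK)).
have DnK' y : y \in D -> y \notin S -> y \notin K.
  by move=> yD yS; apply: contra (DnK _ yD yS); apply: (subsetP (sub_nbhd K)).
have KnS y : y \notin K -> y \notin S by apply: contra; apply: (subsetP sSK).
have win3 i j : lo <= i < hi -> lo <= j < hi -> f i = f j -> j < i + 3.
  move=> ir jr fE; have fiS := fS _ ir.
  have : j <= i.+2.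
    by apply: (win i j (f i)); rewrite ?DnK' //; [arith | arith | rewrite fE].
  arith.
set K1 := K :|: [set x in p].
have sK1 : S \subset K1 by apply: subset_trans sSK (subsetUl _ _).
have sp1 : strongly_spanned K1 (n + k0 + (size p).+1).
  exact: strongly_spanned_ear spK earp.
have fK1 i : lo <= i < hi -> [/\ f i \in D, f i \in nbhd K1 & f i \notin nbhd S].
  move=> ir; split=> //; last by apply: DnS => //; apply: fS.
  by apply: dominator_nbhd; rewrite !inE memp ?orbT //; arith.
case: (boolP (has [pred z | z \in D] p)) => [/hasP[z zp zD]|/hasPn noD].
  left; exists K1, (n + k0 + (size p).+1).
  have zK := ear_notin earp zp.
  have covlt : cov S < cov K1.
    by apply: cov_lt (zD) _ _ => //; [rewrite !inE zp orbT | apply: KnS].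
  have W := window_near sK1 (isT : 0 < 3) fK1 win3.
  by split=> //; arith.
have fadj i : lo <= i < hi -> adj (f i) (nth s p i).
  move=> ir; case: (fcl i) => // fE; have := noD (nth s p i).
  by rewrite /= -fE fD fE memp => [/(_ isT)|]//; arith.
pose E g := [exists y in D, (y \notin K) &&
  [exists i : 'I_(size p), [&& i + g < size p, adj y (nth s p i)
                             & adj y (nth s p (i + g))]]].
have EP g : E g -> 0 < g -> exists y i K2, [/\ y \in D, y \notin K,
    adj y (nth s p i), adj y (nth s p (i + g)) &
    [/\ i + g < size p, S \subset K2, y \in K2,
        forall j, j < size p -> j <= i \/ i + g <= j -> nth s p j \in K2 &
        strongly_spanned K2 (n + k0 + (size p + 3 - g))]].
  case/exists_inP=> y yD /andP[yK /existsP[i /and3P[ig yi yj]]] g0.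
  have yp : y \notin p by apply/negP=> /noD; rewrite /= yD.
  have earq := reroute earp yK yp g0 ig yi yj.
  exists y, i, (K :|: [set x in take i.+1 p ++ y :: drop (i + g) p]); split=> //.
  split=> //.
  - by apply: subset_trans sSK (subsetUl _ _).
  - by rewrite !inE mem_cat mem_head !orbT.
  - by move=> j lj ji; rewrite in_setU [_ \in [set x in _]]inE mem_reroute ?orbT.
  - have := strongly_spanned_ear spK earq.
    have li := ltn_ord i.
    rewrite size_cat /= size_takel // size_drop.
    by have -> : (i.+1 + (size p - (i + g)).+1).+1 = size p + 3 - g by arith.
case: (boolP (E 2)) => [/EP/(_ isT)|noE2].
  case=> y [i [K2 [yD yK yi yj [ig sK2 yK2 pK2 sp2]]]].
  left; exists K2, (n + k0 + (size p + 3 - 2)).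
  have yS := KnS _ yK.
  have covlt : cov S < cov K2 by apply: cov_lt yS.
  have fy j : j < size p -> adj y (nth s p j) -> i <= j <= i + 2.
    move=> lj yj'.
    have := win i j y ltac:(arith) lj yD yK (or_intror yi) (or_intror yj').
    have := win j (i + 2) y lj ltac:(arith) yD yK (or_intror yj') (or_intror yj).
    arith.
  (* Position [i.+1] has lost its vertex and is charged to [y] instead; [fy] keeps the windows at
     width three. *)
  pose h j := if j == i.+1 then y else f j.
  have W : hi - lo + 3 * near S <= 3 * near K2.
    apply: (@window_near _ _ h) => // [j jr|j j' jr jr']; rewrite /h.
      case: eqP => [_|jE].
        by split=> //; [exact: (subsetP (sub_nbhd _)) | exact: DnS].
      split=> //; last by apply: DnS => //; apply: fS.
      by apply: dominator_nbhd; apply: pK2; [arith | arith].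
    case: eqP => [->|jE]; case: eqP => [->|jE'] //; try arith.
    - move=> yE; have := fy j' ltac:(arith).
      by rewrite yE => /(_ (fadj _ jr')); arith.
    - move=> yE; have := fy j ltac:(arith).
      by rewrite -yE => /(_ (fadj _ jr)); arith.
    - exact: win3.
  by split=> //; arith.
have win2 i j : lo <= i < hi -> lo <= j < hi -> f i = f j -> j < i + 2.
  move=> ir jr fE; have lt3 := win3 _ _ ir jr fE.
  case: (ltnP j (i + 2)) => // le2; case/negP: noE2.
  have jE : j = i + 2 by arith.
  apply/exists_inP; exists (f i) => //; rewrite DnK' ?fS //=.
  have li : i < size p by arith.
  apply/existsP; exists (Ordinal li) => /=; rewrite fadj // -jE fE fadj // !andbT.
  arith.
case: (boolP (E 1)) => [/EP/(_ isT)|noE1].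
  case=> y [i [K2 [yD yK yi yj [ig sK2 yK2 pK2 sp2]]]].
  left; exists K2, (n + k0 + (size p + 3 - 1)).
  have yS := KnS _ yK.
  have covlt : cov S < cov K2 by apply: cov_lt yS.
  (* Windows of width two leave one spare unit per new dominator, which pays for the extra arc of
     the insertion. *)
  have W : hi - lo + 2 * near S <= 2 * near K2.
    apply: (@window_near _ _ f) => // j jr; split=> //.
      by apply: dominator_nbhd; apply: pK2; [arith | arith].
    by apply: DnS => //; apply: fS.
  by split=> //; arith.
have win1 i j : lo <= i < hi -> lo <= j < hi -> f i = f j -> j < i + 1.
  move=> ir jr fE; have lt2 := win2 _ _ ir jr fE.
  case: (ltnP j (i + 1)) => // le1; case/negP: noE1.
  have jE : j = i + 1 by arith.
  apply/exists_inP; exists (f i) => //; rewrite DnK' ?fS //=.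
  have li : i < size p by arith.
  apply/existsP; exists (Ordinal li) => /=; rewrite fadj // -jE fE fadj // !andbT.
  arith.
have W := window_near sK1 (isT : 0 < 1) fK1 win1.
have covle := cov_le sK1.
(* The gain [3 * (hi - lo)] covers [hi - lo + 4] once [hi - lo] is at least 2. *)
case: (ltnP lo.+1 hi) => lt; last by right; split=> //; arith.
by left; exists K1, (n + k0 + (size p).+1); split=> //; arith.
Qed.

(** A new vertex [y] of [D] that is not a value of [f] contributes a full [g] of its own. *)
Lemma window_near1 S K (f : nat -> G) y lo hi g : S \subset K -> 0 < g ->
  y \in D -> y \in nbhd K -> y \notin nbhd S ->
  (forall i, lo <= i < hi ->
     [/\ f i \in D, f i \in nbhd K, f i \notin nbhd S & f i != y]) ->
  (forall i j, lo <= i < hi -> lo <= j < hi -> f i = f j -> j < i + g) ->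
  hi - lo + g * (near S).+1 <= g * near K.
Proof.
move=> sSK g0 yD yK yS fP win; rewrite -(nearD sSK).
have yY : y \in (D :&: nbhd K) :\: nbhd S by rewrite in_setD yS in_setI yD yK.
rewrite (cardsD1 y) yY add1n addnS -addSn mulnDr addnC leq_add2l.
apply: window_count win => // i /fP[fD fK fS fy].
by rewrite in_setD1 in_setD in_setI fy fS fD fK.
Qed.

Lemma nbhdP S x : x \in nbhd S -> x \notin S -> exists2 s, s \in S & adj s x.
Proof. by rewrite inE => /orP[->//|/exists_inP]. Qed.

(** * Absorbing a vertex of the dominating set at distance 1 *)

(** An ear leaves through a pending vertex [d], one of [D] at distance 1, and stops at [S] or at
    another pending vertex [t], then prolonged to [S]. New dominators pay [size p - 3] and each
    absorbed pending vertex pays 4; the cost is [size p + 1] or [size p + 2]. *)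
Lemma absorb_pending S n : strongly_spanned S n ->
  n + 7 <= 4 * cov S + 3 * near S -> cov S < near S ->
  exists K m, [/\ strongly_spanned K m, m + 7 <= 4 * cov K + 3 * near K
                & cov S < cov K].
Proof.
move=> spS good lt.
have [d dDN dS] : exists2 d, d \in D :&: nbhd S & d \notin S.
  apply/subsetPn; apply/negP=> sub; move: lt; rewrite ltnNge => /negP; apply.
  by apply: subset_leq_card; rewrite subsetI subsetIl.
move: (dDN); rewrite inE => /andP[dD dN].
have [s sS sd] := nbhdP dN dS.
(* Putting the other pending vertices into the target prevents them from dominating inner
   positions. *)
pose B := S :|: ((D :&: nbhd S) :\ d).
have sB : s \in B by rewrite inE sS.
have dB : d \notin B by rewrite in_setU in_setD1 eqxx (negPf dS).
have SB x : x \in S -> x \in B by rewrite inE => ->.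
have [p' [t geo]] := geodesic_ear_exists connG noG sB dB sd.
set p := d :: p' in geo; have [earp ga gb _] := geo.
pose f i := dominator (nth s p i).
have fD i : f i \in D by case: (dominatorP (nth s p i)).
have fcl i : f i = nth s p i \/ adj (f i) (nth s p i).
  by case: (dominatorP (nth s p i)).
have memp i : i < size p -> nth s p i \in p by move=> ?; apply: mem_nth.
have pB i : i < size p -> nth s p i \notin B.
  by move=> li; apply: ear_notin earp (memp _ li).
have [_ tB pth up _] := and5P earp.
(* Position 0 is [d], position 1 may be dominated by [d], and the last position may see [B]; none of
   these is counted. *)
have fN i : 2 <= i < (size p).-1 -> f i \notin nbhd S.
  move=> ir; apply/negP=> fS.
  have li : i < size p by arith.
  have fnd : f i != d.
    apply/eqP=> fd; case: (fcl i) => [pE|].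
      have /eqP : nth s p 0 = nth s p i by rewrite -pE fd.
      by rewrite nth_uniq // => /eqP; arith.
    by rewrite fd => /(gb 0 i isT li); arith.
  have fB : f i \in B by rewrite in_setU in_setD1 fnd in_setI fD fS orbT.
  case: (fcl i) => [pE|]; first by have := pB _ li; rewrite -pE fB.
  rewrite adj_sym => /(ga i (f i) ltac:(arith) fB)[i0 _]; arith.
have fB i : 2 <= i < (size p).-1 -> f i \notin B.
  move=> /fN; apply: contra; rewrite in_setU in_setD1 in_setI.
  by case/orP=> [/(subsetP (sub_nbhd S)) //|/and3P[]].
have win i j : 2 <= i < (size p).-1 -> 2 <= j < (size p).-1 -> f i = f j -> j < i + 3.
  move=> ir jr fE; have : j <= i.+2.
    apply: (geodesic_ear_window geo _ _ (fB _ ir)) => //; [arith | arith |].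
    by rewrite fE.
  arith.
have W K : S \subset K -> {subset p <= K} ->
    (size p).-1 - 2 + 3 * near S <= 3 * near K.
  move=> sSK spK; apply: window_near win => // i ir; split=> //; last exact: fN.
  by apply: dominator_nbhd; apply: spK; apply: memp; arith.
have pS : all [pred x | x \notin S] p.
  by apply/allP=> x xp; apply: contra (ear_notin earp xp); apply: SB.
set K := S :|: [set x in p].
have sSK : S \subset K by apply: subsetUl.
have covK : cov S < cov K by apply: cov_lt dS => //; rewrite !inE eqxx orbT.
case: (boolP (t \in S)) => tS.
  exists K, (n + (size p).+1); split=> //.
    apply: (strongly_spanned_ear (s := s) (t := t) spS); apply/and5P; split=> //.
    by apply/and3P; split=> //; case/and5P: earp => _ _ _ _ /and3P[].
  have pK : {subset p <= K}.
    by move=> x xp; rewrite in_setU [x \in [set _ in _]]inE xp orbT.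
  by have := W K sSK pK; arith.
have /and3P[td tD tN] : [&& t != d, t \in D & t \in nbhd S].
  by move: tB; rewrite in_setU (negPf tS) in_setD1 in_setI.
have [t' t'S t't] := nbhdP tN tS.
set K' := S :|: [set x in rcons p t].
have sSK' : S \subset K' by apply: subsetUl.
have sKK' : K \subset K'.
  by apply: setUS; apply/subsetP=> x; rewrite inE => xp; rewrite inE mem_rcons inE xp orbT.
have tp : t \notin p by apply/negP=> /(ear_notin earp); rewrite tB.
have covK' : cov K < cov K'.
  apply: (cov_lt sKK' tD); first by rewrite in_setU inE mem_rcons mem_head orbT.
  by rewrite in_setU inE (negPf tS) (negPf tp).
exists K', (n + (size (rcons p t)).+1); split=> //.
- apply: (strongly_spanned_ear (s := s) (t := t') spS); apply/and5P; split=> //.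
  + by rewrite rcons_path pth last_rcons adj_sym t't.
  + by rewrite rcons_uniq tp.
  + by apply/and3P; split=> //; rewrite ?size_rcons // all_rcons; apply/andP; split.
- have pK' : {subset p <= K'}.
    by move=> x xp; rewrite in_setU inE mem_rcons inE xp !orbT.
  by rewrite size_rcons; have := W K' sSK' pK'; arith.
- exact: ltn_trans covK covK'.
Qed.

(** * Progress when no vertex is pending *)

Lemma notin_nbhd S y : D :&: nbhd S \subset S -> y \in D -> y \notin S ->
  y \notin nbhd S.
Proof. by move=> DS yD; apply: contra => yN; apply: (subsetP DS); rewrite inE yD. Qed.

Lemma mem_nth_ear K s p t i : ear K s p t -> i < size p ->
  nth s p i \in p /\ nth s p i \notin K.
Proof.
move=> earp li; have ip : nth s p i \in p by apply: mem_nth.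
by split=> //; apply: ear_notin earp ip.
Qed.

Lemma sub_ear S p : {subset p <= S :|: [set x in p]}.
Proof. by move=> x xp; rewrite in_setU [x \in [set _ in _]]inE xp orbT. Qed.

(** This settles the exception of [long_ear], a four-arc ear with perhaps a single new dominator. A
    second ear, from [x2] through [y] back to the first, absorbs [y]. *)
Lemma square_ear S n s x1 x2 x3 t y : strongly_spanned S n ->
  D :&: nbhd S \subset S -> ear S s [:: x1; x2; x3] t ->
  {in [:: x1; x2; x3], forall x, x \notin D} ->
  y \in D -> y \notin S -> adj x2 y -> progress S n.
Proof.
move=> spS DS earx xD yD yS x2y.
have [sS _ pthx ux _] := and5P earx.
set K := S :|: [set x in [:: x1; x2; x3]].
have spK : strongly_spanned K (n + 4) := strongly_spanned_ear spS earx.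
have sSK : S \subset K by apply: subsetUl.
have xK : {subset [:: x1; x2; x3] <= K} by apply: sub_ear.
have DK z : z \in D -> z \notin S -> z \notin K.
  move=> zD zS; rewrite in_setU (negPf zS) /= inE.
  by apply/negP=> /xD; rewrite zD.
have x2K : x2 \in K by apply: xK; rewrite !inE eqxx orbT.
have yK := DK _ yD yS; have yN := notin_nbhd DS yD yS.
have [p' [t' geo]] := geodesic_ear_exists connG noG x2K yK x2y.
set p := y :: p' in geo; have [earp ga gb _] := geo.
have [_ _ pthp up _] := and5P earp.
set K' := K :|: [set x in p].
have pK' : {subset p <= K'} by apply: sub_ear.
have sKK' : S \subset K' by apply: subset_trans sSK (subsetUl _ _).
have spK' : strongly_spanned K' (n + 4 + (size p).+1).
  exact: strongly_spanned_ear spK earp.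
have yp : y \in p by rewrite mem_head.
have covK' : cov S < cov K' by apply: cov_lt yS => //; apply: pK'.
have nearK' : near S < near K'.
  by apply: near_lt yN => //; apply: (subsetP (sub_nbhd _)); apply: pK'.
(* At most 4 + 3 arcs, against 4 for absorbing [y] and 3 for first seeing it. *)
case: (leqP (size p) 2) => lep.
  by exists K', (n + 4 + (size p).+1); split=> //; arith.
pose f i := dominator (nth x2 p i).
have fD i : f i \in D by case: (dominatorP (nth x2 p i)).
have fcl i : f i = nth x2 p i \/ adj (f i) (nth x2 p i).
  by case: (dominatorP (nth x2 p i)).
have fny i : 2 <= i < size p -> f i != y.
  move=> ir; have li : i < size p by arith.
  apply/eqP=> fd; case: (fcl i) => [pE|].
    have /eqP : nth x2 p 0 = nth x2 p i by rewrite -pE fd.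
    by rewrite nth_uniq // => /eqP; arith.
  by rewrite fd => /(gb 0 i isT ltac:(arith)); arith.
have fS i : 2 <= i < (size p).-1 -> f i \notin S.
  move=> ir; apply/negP=> fS; have fK := subsetP sSK _ fS.
  have [_ pK] := mem_nth_ear earp (ltac:(arith) : i < size p).
  case: (fcl i) => [pE|]; first by move: pK; rewrite -pE fK.
  by rewrite adj_sym => /(ga i (f i) ltac:(arith) fK)[i0 _]; arith.
have win i j : i < size p -> j < size p -> f i \notin S -> f i = f j -> j < i + 3.
  move=> li lj fiS fE; have : j <= i.+2.
    by apply: (geodesic_ear_window geo li lj (DK _ (fD i) fiS)); rewrite // fE.
  arith.
pose z := nth x2 p (size p).-1.
have lz : (size p).-1 < size p by arith.
case: (boolP (f (size p).-1 \in S)) => fzS; last first.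
  have fS' i : 2 <= i < size p -> f i \notin S.
    move=> ir; case: (ltnP i (size p).-1) => li; first by apply: fS; arith.
    by have -> : i = (size p).-1 by arith.
  (* The cost [size p + 5] is met by 4 + 3 for [y] and [size p - 2] for the positions from 2 on. *)
  have W : size p - 2 + 3 * (near S).+1 <= 3 * near K'.
    apply: (@window_near1 _ _ f y) => // [|i ir|i j ir jr].
    - by apply: (subsetP (sub_nbhd _)); apply: pK'.
    - split=> //; last exact: fny.
        apply: dominator_nbhd; apply: pK'.
        by case: (mem_nth_ear earp (ltac:(arith) : i < size p)).
      by apply: notin_nbhd => //; apply: fS'.
    - by apply: win; [arith | arith | apply: fS'].
  by exists K', (n + 4 + (size p).+1); split=> //; arith.
(* The last vertex of [p] is dominated from [S], so one ear ending there replaces both; it omits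
   [x3] and has [size p + 3] arcs. *)
have earq : ear S s (x1 :: x2 :: p) (f (size p).-1).
  have xnp x : x \in [:: x1; x2; x3] -> x \notin p.
    by move=> /xK xK'; apply/negP=> /(ear_notin earp); rewrite xK'.
  apply/and5P; split=> //.
  - have pthq : path (@adj G) x2 (rcons p (f (size p).-1)).
      have [_ zK] := mem_nth_ear earp lz.
      move: pthp; rewrite !rcons_path => /andP[-> _] /=.
      have -> : last y p' = nth x2 p (size p).-1 by rewrite (last_nth x2).
      case: (fcl (size p).-1) => [pE|]; last by rewrite adj_sym.
      by move: zK; rewrite -pE (subsetP sSK _ fzS).
    case/and3P: pthx => sx1 x12 _.
    by rewrite !rcons_cons [path _ _ _]/= sx1 x12.
  - have x1p : x1 \notin p by apply: xnp; rewrite inE eqxx.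
    have x2p : x2 \notin p by apply: xnp; rewrite !inE eqxx orbT.
    have x12 : x1 != x2 by move: ux; rewrite /= !inE negb_or => /andP[/andP[]].
    by rewrite cons_uniq cons_uniq up in_cons negb_or x1p x2p x12.
  - apply/and3P; split=> //.
    have xS x : x \in [:: x1; x2; x3] -> x \notin S by apply: ear_notin earx.
    apply/allP=> x; rewrite in_cons in_cons => /or3P[/eqP->|/eqP->|xp].
    - by apply: xS; rewrite inE eqxx.
    - by apply: xS; rewrite !inE eqxx orbT.
    by apply: contra (ear_notin earp xp); apply: (subsetP sSK).
set K2 := S :|: [set x in x1 :: x2 :: p].
have pK2 : {subset p <= K2}.
  by move=> x xp; apply: sub_ear; rewrite in_cons in_cons xp !orbT.
have sSK2 : S \subset K2 by apply: subsetUl.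
have covK2 : cov S < cov K2 by apply: cov_lt yS => //; apply: pK2.
have W : (size p).-1 - 2 + 3 * (near S).+1 <= 3 * near K2.
  apply: (@window_near1 _ _ f y) => // [|i ir|i j ir jr].
  - by apply: (subsetP (sub_nbhd _)); apply: pK2.
  - split=> //; last by apply: fny; arith.
      apply: dominator_nbhd; apply: pK2.
      by case: (mem_nth_ear earp (ltac:(arith) : i < size p)).
    by apply: notin_nbhd => //; apply: fS.
  - by apply: win; [arith | arith | apply: fS].
have spK2 : strongly_spanned K2 (n + (size p).+3).
  exact: strongly_spanned_ear spS earq.
by exists K2, (n + (size p).+3); split=> //; arith.
Qed.

(** All positions but the first and last have dominators outside [S]. The exception of [long_ear] is
    then a three-vertex ear, left to [square_ear]. *)
Lemma geodesic_ear_progress S n s p t : strongly_spanned S n ->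
  D :&: nbhd S \subset S -> geodesic_ear S s p t -> 2 < size p -> progress S n.
Proof.
move=> spS DS geo lep; have [earp ga gb _] := geo.
have fS i : 1 <= i < (size p).-1 -> dominator (nth s p i) \notin S.
  move=> ir; apply/negP=> fS.
  have [_ pS] := mem_nth_ear earp (ltac:(arith) : i < size p).
  case: (dominatorP (nth s p i)) => _ [pE|]; first by move: pS; rewrite -pE fS.
  by rewrite adj_sym => /(ga i _ ltac:(arith) fS)[i0 _]; arith.
have win i j y : i < size p -> j < size p -> y \in D -> y \notin S ->
     y = nth s p i \/ adj y (nth s p i) ->
     y = nth s p j \/ adj y (nth s p j) -> j <= i.+2.
  by move=> li lj _; apply: (geodesic_ear_window geo).
have spS0 : strongly_spanned S (n + 0) by rewrite addn0.
case: (long_ear spS0 (subxx _) DS earp _ fS win) => [|||[hE noD]] //; try arith.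
have size3 : size p = 3 by arith.
case: p size3 {lep hE win} earp geo ga gb fS noD => [|x1 [|x2 [|x3 [|]]]] //= _.
move=> earp geo ga gb fS noD; have := fS 1 isT; set y := dominator _ => yS.
have [yD ycl] := dominatorP x2.
apply: (square_ear spS DS earp noD yD yS).
case: ycl => [yE|]; last by rewrite adj_sym.
by rewrite yE in yD; have := noD x2; rewrite yD !inE eqxx orbT => /(_ isT).
Qed.

(** If a vertex adjacent to [S] sees a vertex of [D] outside [S], one ear through it is enough.
    Otherwise a short first ear through [x1] sees nothing new, and a second ear continues from [x1]
    to a vertex [x2] at distance 2 from [S]. *)
Lemma progress_exists S n : strongly_spanned S n -> S != set0 ->
  D :&: nbhd S \subset S -> ~~ (D \subset S) -> progress S n.
Proof.
move=> spS /set0Pn[s0 s0S] DS /subsetPn[d dD dS].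
have dN := notin_nbhd DS dD dS.
case: (boolP [exists x in nbhd S, (x \notin S) &&
               [exists y in D, (y \notin S) && adj x y]]).
  case/exists_inP=> x xN /andP[xS /exists_inP[y yD /andP[yS xy]]].
  have [s sS sx] := nbhdP xN xS.
  have [p' [t geo]] := geodesic_ear_exists connG noG sS xS sx.
  case: (ltnP 2 (size (x :: p'))) => lep.
    exact: geodesic_ear_progress spS DS geo lep.
  have [earp _ _ _] := geo.
  have spK := strongly_spanned_ear spS earp; move: spK.
  set K := (X in strongly_spanned X _) => spK.
  have sSK : S \subset K by apply: subsetUl.
  (* The ear has at most three arcs, paid for by first seeing [y]. *)
  have nearK : near S < near K.
    apply: (near_lt sSK yD) (notin_nbhd DS yD yS).
    by apply: adj_nbhd xy; apply: sub_ear; rewrite mem_head.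
  have covK := cov_le sSK.
  by exists K, (n + (size (x :: p')).+1); split=> //; arith.
move=> /exists_inPn far.
have {}far x y : x \in nbhd S -> x \notin S -> y \in D -> adj x y -> y \in S.
  move=> xN xS yD xy; apply: contraT => yS; case/negP: (far x xN).
  by rewrite xS; apply/exists_inP; exists y; rewrite ?yS.
have [x1 [x2 [x1N x2N x12]]] :=
  connect_crossing (connG.2 s0 d) (subsetP (sub_nbhd S) _ s0S) dN.
have x1S : x1 \notin S by apply: contra x2N => x1S; apply: adj_nbhd x12.
have [s sS sx1] := nbhdP x1N x1S.
have [p' [t geo]] := geodesic_ear_exists connG noG sS x1S sx1.
case: (ltnP 2 (size (x1 :: p'))) => lep.
  exact: geodesic_ear_progress spS DS geo lep.
have [earp _ _ _] := geo.
have pN : {subset x1 :: p' <= nbhd S}.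
  have [_ tS pth _ _] := and5P earp.
  case: p' lep earp geo pth => [|x3 [|//]] _ _ _ /= pth x.
    by rewrite mem_seq1 => /eqP->.
  rewrite in_cons mem_seq1 => /orP[/eqP-> //|/eqP->].
  case/and3P: pth => _ _ /andP[x3t _]; apply: (adj_nbhd tS).
  by rewrite adj_sym.
have spK := strongly_spanned_ear spS earp; move: spK.
set K := (X in strongly_spanned X _) => spK.
have sSK : S \subset K by apply: subsetUl.
have KN z : z \in K -> z \in nbhd S.
  rewrite in_setU [z \in [set _ in _]]inE.
  by case/orP=> [/(subsetP (sub_nbhd S))|/pN].
(* The vertices of the first ear stay within distance 1 of [S], so [far] applies to them. *)
have DK : D :&: nbhd K \subset S.
  apply/subsetP=> y; rewrite in_setI => /andP[yD yN].
  have DNS : y \in nbhd S -> y \in S.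
    by move=> yNS; apply: (subsetP DS); rewrite in_setI yD.
  case: (boolP (y \in K)) => yK; first by apply: DNS; apply: KN.
  have [z zK zy] := nbhdP yN yK.
  case: (boolP (z \in S)) => zS; first by apply: DNS; apply: adj_nbhd zy.
  by apply: (far z) => //; apply: KN.
have DnK y : y \in D -> y \notin S -> y \notin K.
  move=> yD; apply: contra => yK; apply: (subsetP DK).
  by rewrite in_setI yD (subsetP (sub_nbhd K)).
have x1K : x1 \in K by apply: sub_ear; rewrite mem_head.
have x2K : x2 \notin K by apply: contra x2N; apply: KN.
have x2S : x2 \notin S by apply: contra x2K; apply: (subsetP sSK).
have x1D : x1 \notin D.
  by apply: contra x1S => x1D; apply: (subsetP DS); rewrite in_setI x1D.
have [p2 [t2 geo2]] := geodesic_ear_exists connG noG x1K x2K x12.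
set P := x2 :: p2 in geo2; have [earP ga gb _] := geo2.
have [_ t2K pthP uP _] := and5P earP.
have nthE i : i < size P -> nth x1 P i = nth s P i by apply: set_nth_default.
pose f i := dominator (nth x1 P i).
have fD i : f i \in D by case: (dominatorP (nth x1 P i)).
have fcl i : f i = nth x1 P i \/ adj (f i) (nth x1 P i).
  by case: (dominatorP (nth x1 P i)).
have fS i : i.+1 < size P -> f i \notin S.
  move=> li; apply/negP=> fS; have fK := subsetP sSK _ fS.
  have [_ pK] := mem_nth_ear earP (ltnW li).
  case: (fcl i) => [pE|]; first by move: pK; rewrite -pE fK.
  rewrite adj_sym => /(ga i (f i) li fK)[_ fx1].
  by rewrite fx1 (negPf x1S) in fS.
have winK i j y : i < size P -> j < size P -> y \in D -> y \notin S ->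
     y = nth x1 P i \/ adj y (nth x1 P i) ->
     y = nth x1 P j \/ adj y (nth x1 P j) -> j <= i.+2.
  by move=> li lj yD yS; apply: (geodesic_ear_window geo2 li lj (DnK _ yD yS)).
have x2f : f 0 \notin S -> x2 \notin D -> exists2 y, y \in D /\ y \notin S & adj x2 y.
  move=> f0S x2D; exists (f 0) => //; case: (fcl 0) => [pE|]; last by rewrite adj_sym.
  by move: (fD 0); rewrite pE /= (negPf x2D).
pose l := (size P).-1; have lE : l.+1 = size P by [].
have ll : l < size P by rewrite -lE.
(* When the last vertex is dominated from [S], the second ear can end there and begin at [s],
   becoming a single ear on [S]. *)
case: (boolP (f l \in S)) => flS.
  have l0 : 0 < l.
    rewrite lt0n; apply/eqP=> l0; move: flS; rewrite l0 => f0S.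
    case: (fcl 0) => [/= pE|/= fx2]; first by rewrite -pE f0S in x2S.
    by rewrite (adj_nbhd f0S fx2) in x2N.
  have earq : ear S s (x1 :: P) (f l).
    apply/and5P; split=> //.
    - rewrite rcons_cons; apply/andP; split=> //.
      suff: path (@adj G) x1 (rcons P (f l)) by [].
      move: pthP; rewrite !rcons_path => /andP[-> _] /=.
      have -> : last x2 p2 = nth x1 P l by rewrite (last_nth x1).
      case: (fcl l) => [pE|]; last by rewrite adj_sym.
      have [_ pK] := mem_nth_ear earP ll.
      by move: pK; rewrite -pE (subsetP sSK _ flS).
    - rewrite cons_uniq uP andbT; apply/negP=> /(ear_notin earP).
      by rewrite x1K.
    - apply/and3P; split=> //; apply/allP=> x.
      rewrite in_cons => /orP[/eqP-> //|xP].
      by apply: contra (ear_notin earP xP); apply: (subsetP sSK).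
  have fS' i : 1 <= i < size P -> dominator (nth s (x1 :: P) i) \notin S.
    case: i => // i /andP[_ li]; rewrite [nth _ _ _]/= -nthE; last exact: ltnW.
    exact: fS.
  have win i j y : i < size (x1 :: P) -> j < size (x1 :: P) -> y \in D -> y \notin S ->
     y = nth s (x1 :: P) i \/ adj y (nth s (x1 :: P) i) ->
     y = nth s (x1 :: P) j \/ adj y (nth s (x1 :: P) j) -> j <= i.+2.
    move=> li lj yD yS.
    have nx1 : ~ (y = x1 \/ adj y x1).
      case=> [yx|]; first by rewrite -yx yD in x1D.
      by rewrite adj_sym => /(far _ _ x1N x1S yD); rewrite (negPf yS).
    case: i j li lj => [|i] [|j] li lj // yi yj; try by case: nx1.
    by apply: (winK i j y) => //; rewrite nthE.
  have spS0 : strongly_spanned S (n + 0) by rewrite addn0.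
  have sz : size (x1 :: P) = (size P).+1 by [].
  case: (long_ear spS0 (subxx _) DS earq _ fS' win) => [|||[hE noD]] //.
  - by rewrite sz; arith.
  - by rewrite sz; arith.
  have {}noD x : x \in x1 :: P -> x \notin D by apply: noD.
  have x2D : x2 \notin D by apply: noD; rewrite !in_cons eqxx orbT.
  have [y [yD yS] x2y] := x2f (fS 0 ltac:(arith)) x2D.
  have [x3 PE] : exists x3, P = [:: x2; x3].
    by move: hE; rewrite /P; case: (p2) => [|x3 []] // _; exists x3.
  rewrite PE in earq noD.
  exact: (square_ear spS DS earq noD yD yS x2y).
(* Otherwise every position of [P] counts, which leaves room for the at most three arcs of the first
   ear. *)
have fSl i : 0 <= i < size P -> dominator (nth x1 P i) \notin S.
  move=> /andP[_ li]; case: (ltnP i.+1 (size P)) => [/fS //|le].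
  by have -> : i = l by arith.
case: (long_ear spK sSK DK earP _ fSl) => [||||[hE noD]] //.
- by move=> i j y li lj yD yK; apply: winK => //; apply: contra yK; apply: (subsetP sSK).
- by arith.
have {}noD x : x \in P -> x \notin D by apply: noD.
have x2D : x2 \notin D by apply: noD; rewrite mem_head.
have [y [yD yS] x2y] := x2f (fSl 0 isT) x2D.
(* The second ear only passes through [x2], so the first is [s], [x1], [t2], [t]; replacing its
   middle edge by the path through [x2] gives a four-arc ear. *)
have PE : P = [:: x2] by move: hE; rewrite /P; case: (p2).
rewrite PE in earP pthP.
have /and5P[_ _ _ _ /and3P[_ _ /= x1t2]] := earP.
have x2t2 : adj x2 t2 by move: pthP => /= /and3P[].
have t2S : t2 \notin S by apply: contra x2N => t2S; apply: adj_nbhd t2S _; rewrite adj_sym.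
have p'E : p' = [:: t2].
  move: t2K; rewrite in_setU (negPf t2S) /= inE in_cons eq_sym (negPf x1t2) /=.
  by case: (p') lep => [|a [|]] //= _; rewrite inE => /eqP->.
have [_ tS pthp up _] := and5P earp.
rewrite p'E in pthp up pN earp.
have t2D : t2 \notin D.
  apply: contra t2S => t2D; apply: (subsetP DS); rewrite in_setI t2D.
  by apply: pN; rewrite !inE eqxx orbT.
have ear3 : ear S s [:: x1; x2; t2] t.
  apply/and5P; split=> //.
  - by move: pthp => /= /and3P[-> _ ->]; rewrite x12 x2t2.
  - rewrite /= !inE andbT negb_or x1t2 !andbT; apply/andP; split.
      by apply: contraTneq x12 => ->; rewrite adj_irrefl.
    by apply: contraTneq x2t2 => ->; rewrite adj_irrefl.
  - by rewrite /= x1S x2S t2S.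
apply: (square_ear spS DS ear3 _ yD yS x2y) => x.
by rewrite !inE => /or3P[] /eqP->.
Qed.

(** Induction on the number of vertices of [D] still missing. A progress step that absorbs none
    raises [near] above [cov], so that [absorb_pending] applies next. A single vertex of [D] starts
    the growth, as 0 + 7 = 4 + 3. *)
Lemma spanning_strong_subgraph :
  exists S n, [/\ D \subset S, strongly_spanned S n & n + 7 <= 7 * #|D|].
Proof.
have cov_max S : cov S <= #|D| by apply: subset_leq_card; apply: subsetIl.
have near_max S : near S <= #|D| by apply: subset_leq_card; apply: subsetIl.
have grow k : forall S n, #|D| - cov S <= k -> strongly_spanned S n ->
    n + 7 <= 4 * cov S + 3 * near S ->
    exists K m, [/\ D \subset K, strongly_spanned K m & m + 7 <= 7 * #|D|].
  elim: k => [|k IHk] S n le spS good; have := cov_max S; have := near_max S.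
    move=> lt1 lt2; exists S, n; split=> //; last by arith.
    have /eqP <- : D :&: S == D by rewrite eqEcard subsetIl; rewrite /cov in le; arith.
    exact: subsetIr.
  move=> lt1 lt2; case: (boolP (D \subset S)) => DS.
    by exists S, n; split=> //; arith.
  case: (ltnP (cov S) (near S)) => lt.
    have [K [m [spK goodK covK]]] := absorb_pending spS good lt.
    by apply: (IHk K m) => //; have := cov_max K; arith.
  (* The empty set violates the invariant. *)
  have S0 : S != set0.
    apply: contraTneq good => S0; rewrite /cov /near S0 setI0.
    suff -> : nbhd set0 = set0 by rewrite setI0 !cards0 addnS.
    apply/setP=> x; rewrite !inE; apply/exists_inP=> -[s].
    by rewrite inE.
  have DN : D :&: nbhd S \subset S.
    have /eqP <- : D :&: S == D :&: nbhd S.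
      by rewrite eqEcard setIS ?sub_nbhd.
    exact: subsetIr.
  have [K [m [spK nearK covK cost]]] := progress_exists spS S0 DN DS.
  have goodK : m + 7 <= 4 * cov K + 3 * near K by arith.
  have := cov_max K; case: (ltnP (cov S) (cov K)) => covSK leK.
    by apply: (IHk K m) => //; arith.
  have ltK : cov K < near K.
    have : cov S <= near S by apply: subset_leq_card; rewrite setIS ?sub_nbhd.
    arith.
  have [L [m' [spL goodL covL]]] := absorb_pending spK goodK ltK.
  by apply: (IHk L m') => //; have := cov_max L; arith.
have [x xG] : exists x, x \in G by case: connG => /card_gt0P[x]; exists x.
have [dD _] := dominatorP x; set d := dominator x in dD.
apply: (grow #|D| [set d] 0); rewrite ?leq_subr //.
  exact: strongly_spanned_set1.
have : 0 < cov [set d] by apply/card_gt0P; exists d; rewrite !inE dD eqxx.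
have : 0 < near [set d].
  by apply/card_gt0P; exists d; rewrite in_setI dD (subsetP (sub_nbhd _)) ?inE.
arith.
Qed.

End Growth.

(** * Orienting the remaining edges *)

Section Orientation.

Variable G : sgraph.
Implicit Types (S I : {set G}) (A F : {set G * G}) (x y : G).

(** Edges with no arc in [F] are directed by increasing rank in the enumeration. *)
Lemma extend_orientation F :
  (forall x y, (x, y) \in F -> adj x y) ->
  (forall x y, (x, y) \in F -> (y, x) \notin F) ->
  exists2 A, orientation A & F \subset A.
Proof.
move=> Fadj Fanti.
exists [set a | adj a.1 a.2 && ((a \in F) ||
    ((a.2, a.1) \notin F) && (enum_rank a.1 < enum_rank a.2))]; last first.
  by apply/subsetP=> -[x y] xyF; rewrite inE /= xyF Fadj.
split=> [x y|x y xy]; rewrite !inE /=; first by case/andP.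
rewrite xy (adj_sym y) xy /=.
case xyF: ((x, y) \in F); first by rewrite (negPf (Fanti _ _ xyF)) /=.
case yxF: ((y, x) \in F) => //=.
have ne : enum_rank x != enum_rank y :> nat.
  apply: contraTneq xy => /ord_inj/enum_rank_inj->; by rewrite adj_irrefl.
by case: ltngtP ne.
Qed.

(** Strong orientations form a decidable finite family, so one witness yields a minimum. *)
Lemma oriented_sdiam_exists A : orientation A -> strong A ->
  exists2 k, oriented_sdiam G k & k <= sdiam A.
Proof.
pose good A := [&& [forall x, forall y, ((x, y) \in A) ==> adj x y],
  [forall x, forall y, adj x y ==> ((x, y) \in A) (+) ((y, x) \in A)]
  & [forall x, forall y, connect (arc_rel A) x y]].
have goodP B : reflect (orientation B /\ strong B) (good B).
  apply: (iffP and3P) => [[o1 o2 st]|[[o1 o2] st]].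
    split; [split|] => x y; first by have /forallP/(_ y)/implyP := forallP o1 x.
      by have /forallP/(_ y)/implyP := forallP o2 x.
    exact: (forallP (forallP st x) y).
  split; apply/forallP=> x; apply/forallP=> y; last exact: st.
    by apply/implyP; apply: o1.
  by apply/implyP; apply: o2.
move=> oA sA; have gA : good A by apply/goodP.
case: (arg_minnP (@sdiam G) gA) => B /goodP[oB sB] minB.
exists (sdiam B); last exact: minB.
split; first by exists B.
by move=> C oC sC; apply: minB; apply/goodP.
Qed.

Lemma maximal_independent (O : {set G}) : exists I, [/\ I \subset O,
  {in I &, forall x y, ~~ adj x y} &
  {in O, forall x, x \notin I -> exists2 y, y \in I & adj x y}].
Proof.
pose indep (I : {set G}) := (I \subset O) && [forall x in I, forall y in I, ~~ adj x y].
have ind0 : indep set0 by rewrite /indep sub0set; apply/forall_inP=> x; rewrite inE.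
case: (arg_maxnP (fun I : {set G} => #|I|) ind0) => I /andP[IO /forall_inP indI] maxI.
have {}indI x y : x \in I -> y \in I -> ~~ adj x y.
  by move=> xI yI; apply: (forall_inP (indI x xI)).
exists I; split=> // x xO xI.
case: (boolP [exists y in I, adj x y]) => [/exists_inP[y yI xy]|/exists_inPn none].
  by exists y.
have /maxI : indep (x |: I).
  rewrite /indep subUset sub1set xO IO; apply/forall_inP=> u; rewrite !inE => uI.
  apply/forall_inP=> v; rewrite !inE => vI.
  case/orP: uI => [/eqP->|uI]; case/orP: vI => [/eqP->|vI].
  - by rewrite adj_irrefl.
  - exact: none.
  - by rewrite adj_sym; apply: none.
  - exact: indI.
by rewrite /= cardsU1 xI ltnn.
Qed.

(** A detour around the edge must leave [x] by another one. *)
Lemma second_neighbour x y : bridgeless G -> adj x y ->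
  exists2 z, z != y & adj x z.
Proof.
move=> noG xy; have nxy : x != y by apply: contraTneq xy => ->; rewrite adj_irrefl.
have : connect (remove_edge x y) x y.
  by apply: contraT => /negP nc; case: (noG x y); split=> // -[_ /(_ x y)].
case/connectP=> -[|z q] /= => [_ yx|]; first by rewrite yx eqxx in nxy.
case/andP=> /andP[xz ne] _ _; exists z => //.
by apply: contra ne => /eqP->.
Qed.

End Orientation.

(** * Attaching the outside vertices by ears of at most three arcs *)

Section UpperBound.

Variables (G : sgraph) (D S I : {set G}).
Hypotheses (noG : bridgeless G) (domD : dominating D).
Hypotheses (DS : D \subset S) (IS : I \subset ~: S)
  (indI : {in I &, forall x y, ~~ adj x y})
  (maxI : {in ~: S, forall x, x \notin I -> exists2 y, y \in I & adj x y}).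
Implicit Types (x y u v w : G).

Let d u := dominator D u.

(* A vertex outside [S] that lies in the maximal independent set [I] receives
   an arc from its dominator and sends arcs to the rest of [S] and to the
   vertices outside [S :|: I]; the others do the opposite. *)
Definition attaching_arcs : {set G * G} :=
  [set a | adj a.1 a.2 && (if a.1 \in S
    then (a.2 \notin S) && ((a.1 == d a.2) == (a.2 \in I))
    else if a.2 \in S then (a.2 == d a.1) != (a.1 \in I)
    else (a.1 \in I) && (a.2 \notin I))].

Lemma attaching_arcs_anti x y :
  (x, y) \in attaching_arcs -> (y, x) \notin attaching_arcs.
Proof.
rewrite !inE /= (adj_sym y); case: (adj x y) => //=.
case: (x \in S); case: (y \in S) => //=; first by rewrite negbK.
by case/andP=> -> _; rewrite andbF.
Qed.

Lemma dominator_in u : d u \in S.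
Proof. by apply: (subsetP DS); case: (dominatorP domD u). Qed.

Lemma dominator_adj u : u \notin S -> adj (d u) u.
Proof.
move=> uS; case: (dominatorP domD u) => _ [dE|//].
by case/negP: uS; rewrite -dE; apply: dominator_in.
Qed.

(** If [u] has a neighbour [h] in [S] besides its dominator, the path is [d u], [u], [h] or its
    reverse. Otherwise it uses a neighbour outside [S]: [d u], [u], [w], [d w] for [u] in [I], and
    [d v], [v], [u], [d u] with [v] in [I] for other [u]. *)
Lemma attaching_path u : u \notin S -> exists s p t,
  [/\ s \in S, t \in S, path (arc_rel attaching_arcs) s (rcons p t), size p <= 2
    & u \in p].
Proof.
move=> uS; have dS := dominator_in; have dA := dominator_adj.
case: (boolP [exists h in S, (h != d u) && adj h u]).
  case/exists_inP=> h hS /andP[hd hu].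
  case: (boolP (u \in I)) => uI.
    exists (d u), [:: u], h; split; rewrite ?mem_head ?dS // /arc_rel /= !inE /= hS dS dA // uI.
    by rewrite eqxx (negPf uS) adj_sym hu (negPf hd).
  exists h, [:: u], (d u); split; rewrite ?mem_head ?dS // /arc_rel /= !inE /= hS dS.
  by rewrite hu (adj_sym u) dA // (negPf hd) (negPf uS) (negPf uI) !eqxx.
move=> /exists_inPn noh.
have [w wd uw] : exists2 w, w != d u & adj u w.
  by apply: second_neighbour => //; rewrite adj_sym dA.
have wS : w \notin S.
  by apply/negP=> wS; move: (noh w wS); rewrite wd adj_sym uw.
case: (boolP (u \in I)) => uI.
  have wI : w \notin I by apply/negP=> wI; move: (indI uI wI); rewrite uw.
  exists (d u), [:: u; w], (d w); split; rewrite ?mem_head ?dS // /arc_rel /= !inE /= !dS dA // uI.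
  by rewrite eqxx !(negPf uS) !(negPf wS) uw (negPf wI) (adj_sym w) dA // !eqxx.
have [v vI uv] : exists2 v, v \in I & adj u v by apply: maxI; rewrite ?inE.
have vS : v \notin S by move: (subsetP IS _ vI); rewrite inE.
exists (d v), [:: v; u], (d u); split; rewrite ?dS ?mem_head // ?in_cons ?eqxx ?orbT // /arc_rel /= !inE /= !dS.
by rewrite dA // vI eqxx !(negPf uS) !(negPf vS) (adj_sym v) uv (negPf uI)
  (adj_sym u) dA // !eqxx.
Qed.

Lemma attachment u : exists (X : {set G}) (E : {set G * G}),
  [/\ E \subset attaching_arcs, #|E| <= 3, u \in S :|: X,
      forall x y, (x, y) \in E -> (x \in S :|: X) && (y \in S :|: X)
    & forall x, x \in X -> exists s t,
        [/\ s \in S, t \in S, connect (arc_rel E) s x & connect (arc_rel E) x t]].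
Proof.
case: (boolP (u \in S)) => uS.
  exists set0, set0; split; rewrite ?sub0set ?cards0 ?inE ?uS // => x.
    by move=> y; rewrite inE.
  by rewrite inE.
have [s [p [t [sS tS pth szp up]]]] := attaching_path uS.
pose q := rcons p t; pose E := [set a in zip (belast s q) q].
have sq : size (belast s q) = size q by rewrite size_belast.
exists [set x in p], E; split.
- apply/subsetP=> -[x y]; rewrite inE => xyq.
  move: pth xyq; rewrite -/q; clear -q; elim: q s => //= w q IHq s.
  case/andP=> sw wq; rewrite inE => /orP[/eqP[-> ->] //|].
  exact: IHq.
- rewrite cardsE; apply: leq_trans (card_size _) _.
  by rewrite size_zip sq minnn size_rcons.
- by rewrite !inE up orbT.
- move=> x y; rewrite inE => /(mem_zip_nth s sq)[i lti [xE yE]].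
  have xp : x \in s :: p.
    by rewrite -(belast_rcons s p t) xE; apply: mem_nth.
  have yp : y \in q by rewrite yE; apply: mem_nth; rewrite -sq.
  move: xp yp; rewrite mem_rcons !inE.
  by move=> /orP[/eqP->|->] /orP[/eqP->|->]; rewrite ?sS ?tS ?orbT.
- move=> x; rewrite inE => xp; exists s, t; split=> //.
    have xq : x \in q by rewrite mem_rcons inE xp orbT.
    have [c _] := connect_path_mem (path_mem_zip s q) xq.
    by apply: connect_sub c => a b ab; apply: connect1; rewrite /arc_rel /= inE.
  have xq : x \in q by rewrite mem_rcons inE xp orbT.
  have [_ c] := connect_path_mem (path_mem_zip s q) xq.
  rewrite last_rcons in c.
  by apply: connect_sub c => a b ab; apply: connect1; rewrite /arc_rel /= inE.
Qed.

(** The subdigraph consists of [F] and the attachments of [u] and [v], of at most three arcs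
    each. *)
Lemma pair_subdigraph (F A : {set G * G}) u v : oriented_strong S F -> F \subset A ->
  attaching_arcs \subset A -> exists H, [/\ strong_subdigraph A H, u \in H.1,
  v \in H.1 & #|H.2| <= #|F| + 6].
Proof.
case=> Fadj _ Fstr FA attA.
have [X [E [Eatt E3 uX EX Xc]]] := attachment u.
have [Y [E' [Eatt' E3' vY EY Yc]]] := attachment v.
pose H := (S :|: X :|: Y, F :|: E :|: E').
have cF : subrel (connect (arc_rel F)) (connect (arc_rel H.2)).
  apply: connect_sub => x y xy; apply: connect1.
  by rewrite /arc_rel /= !inE [_ \in F]xy.
have cE : subrel (connect (arc_rel E)) (connect (arc_rel H.2)).
  apply: connect_sub => x y xy; apply: connect1.
  by rewrite /arc_rel /= !inE [_ \in E]xy orbT.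
have cE' : subrel (connect (arc_rel E')) (connect (arc_rel H.2)).
  apply: connect_sub => x y xy; apply: connect1.
  by rewrite /arc_rel /= !inE [_ \in E']xy orbT.
have HS x : x \in H.1 -> exists s t, [/\ s \in S, t \in S,
    connect (arc_rel H.2) s x & connect (arc_rel H.2) x t].
  rewrite /= !inE => /orP[/orP[xS|/Xc]|/Yc].
  - by exists x, x; split.
  - by case=> s [t [sS tS sx xt]]; exists s, t; split=> //; apply: cE.
  - by case=> s [t [sS tS sx xt]]; exists s, t; split=> //; apply: cE'.
exists H; split.
- apply/andP; split; first (apply/andP; split).
  + by rewrite /= !subUset FA (subset_trans Eatt attA) (subset_trans Eatt' attA).
  + apply/forall_inP=> -[x y] xyH.
    have : [|| (x, y) \in F, (x, y) \in E | (x, y) \in E'].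
      by move: xyH; rewrite !in_setU -orbA.
    case/or3P=> [xyF|xyE|xyE].
    * by case: (Fadj _ _ xyF) => _ xS yS; rewrite !inE xS yS.
    * by case/andP: (EX _ _ xyE) => xX yX; rewrite !(in_setU _ _ Y) xX yX.
    * case/andP: (EY _ _ xyE).
      by rewrite !inE => /orP[->|->] /orP[->|->]; rewrite ?orbT.
  + apply/forall_inP=> x /HS[_ [t [_ tS _ xt]]].
    apply/forall_inP=> y /HS[s [_ [sS _ sy _]]].
    apply: connect_trans xt _; apply: connect_trans sy.
    by apply: cF; apply: Fstr.
- by rewrite in_setU uX.
- by move: vY; rewrite /= !inE => /orP[->|->]; rewrite ?orbT.
- apply: leq_trans (leq_card_setU _ _) _.
  rewrite -[6]/(3 + 3) addnA; apply: leq_add => //.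
  by apply: leq_trans (leq_card_setU _ _) _; rewrite leq_add2l.
Qed.

End UpperBound.

Lemma oriented_sdiam_upper (G : sgraph) (D : {set G}) :
  connected G -> bridgeless G -> dominating D ->
  exists2 k, oriented_sdiam G k & k <= 7 * #|D| - 1.
Proof.
move=> connG noG domD.
have [S [n [DS [F strF Fn] bound]]] := spanning_strong_subgraph connG noG domD.
have [I [IS indI maxI]] := maximal_independent (~: S).
have [Fadj Fanti _] := strF.
pose E := attaching_arcs D S I.
(* Attaching arcs have an end outside [S], hence never oppose an arc of [F]. *)
have EnS x y : (x, y) \in E -> ~~ ((x \in S) && (y \in S)).
  by rewrite inE /=; case: (x \in S); case: (y \in S); rewrite ?andbF.
have [A oA FEA] : exists2 A, orientation A & F :|: E \subset A.
  apply: extend_orientation => x y; rewrite !in_setU.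
    by case/orP=> [/Fadj[]//|]; rewrite inE => /andP[].
  case/orP=> [xyF|xyE]; rewrite negb_or.
    rewrite Fanti //=; apply/negP=> /EnS.
    by have [_ -> ->] := Fadj _ _ xyF.
  rewrite attaching_arcs_anti // andbT; apply/negP=> /Fadj[_ yS xS].
  by move: (EnS _ _ xyE); rewrite xS yS.
move: FEA; rewrite subUset => /andP[FA EA].
have pairA u v := pair_subdigraph noG domD DS IS indI maxI u v strF FA EA.
have sA : strong A.
  move=> u v; have [H [/andP[/andP[HA _] /forall_inP Hs] uH vH _]] := pairA u v.
  have := forall_inP (Hs u uH) v vH; apply: connect_sub => x y xy.
  by apply: connect1; apply: (subsetP HA).
have [k kG kA] := oriented_sdiam_exists oA sA; exists k => //.
apply: leq_trans kA _; apply/bigmax_leqP=> u _; apply/bigmax_leqP=> v _.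
have [H [HA uH vH Hn]] := pairA u v.
apply: leq_trans ((sd_min u v sA).2 H HA uH vH) _.
(* At most [n + 6] arcs, where [n + 7 <= 7 * #|D|]. *)
apply: leq_trans Hn _; arith.
Qed.

(** * Sharpness *)

(* The vertices [5i], ..., [5i+4] are named b, c, d, a', a.  In each block d a' a is
   a triangle with dominator d; the vertex a and the b, d, c of the next block form
   a 4-cycle; b c d is a triangle in block 0. *)
Definition fwd (x y : nat) : bool :=
  (y == x.+1) && ((x %% 5 != 0) || (x == 0)) ||
  (y == x.+2) && [|| x %% 5 == 0, x %% 5 == 2 | x %% 5 == 4].

Definition link : rel nat := fun x y => fwd x y || fwd y x.

Lemma fwd_lt x y : fwd x y -> x < y.
Proof. rewrite /fwd; lia. Qed.

Section Chain.

Variable g : nat.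
Hypothesis g_gt0 : 0 < g.

Definition chain_rel : rel 'I_(5 * g) := fun x y => link x y.

Lemma chain_sym : symmetric chain_rel.
Proof. by move=> x y; rewrite /chain_rel /link orbC. Qed.

Lemma chain_irrefl : irreflexive chain_rel.
Proof. by move=> x; apply/negP; rewrite /chain_rel /link orbb => /fwd_lt; rewrite ltnn. Qed.

Definition chain : sgraph := SGraph chain_sym chain_irrefl.

(** * Connectedness and bridgelessness of the chain *)

Lemma chain_gt0 : 0 < 5 * g. Proof. by rewrite muln_gt0. Qed.

Lemma connect_lift (m : nat) (e : rel nat) (r : rel 'I_m) q (x y : 'I_m) :
  (forall a b : 'I_m, e a b -> r a b) -> path e x q -> all (ltn^~ m) q ->
  last (x : nat) q = y -> connect r x y.
Proof.
move=> er; elim: q x => [|z q IHq] x /=; first by move=> _ _ /ord_inj->.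
case/andP=> xz zq /andP[zm qm] ly.
apply: connect_trans (connect1 _) (IHq (Ordinal zm) zq qm ly).
exact: er.
Qed.

Lemma chain_connected : connected chain.
Proof.
split; first by rewrite card_ord chain_gt0.
have to0 (n : nat) (x : chain) : x = n :> nat -> connect (@adj chain) x (Ordinal chain_gt0).
  elim/ltn_ind: n x => n IHn x xn.
  case: (posnP n) => [n0|n_gt0].
    have -> : x = Ordinal chain_gt0 by apply: ord_inj; rewrite xn n0.
    exact: connect0.
  (* The smaller neighbour is [n.-1], or [n.-2] when [n.-1] is a positive multiple of 5. *)
  have [y yn fy] : exists2 y, y < n & fwd y n.
    case: (boolP ((n.-1 %% 5 != 0) || (n.-1 == 0))) => h.
      by exists n.-1; rewrite /fwd; lia.
    by exists n.-2; rewrite /fwd; lia.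
  have ylt : y < 5 * g by apply: ltn_trans yn _; rewrite -xn.
  apply: connect_trans (IHn y yn (Ordinal ylt) erefl); apply: connect1.
  by rewrite /adj /= /chain_rel /link /= xn fy orbT.
move=> x y; apply: connect_trans (to0 x x erefl) _.
by rewrite (sym_connect_sym (@adj_sym chain)); apply: (to0 y).
Qed.

(** The witnesses run around the rest of the triangle or 4-cycle containing the edge. *)
Lemma detour x y : fwd x y -> y < 5 * g -> exists q,
  [/\ path (fun u v => link u v &&
          ~~ ((u == x) && (v == y) || (u == y) && (v == x))) x q,
      all (ltn^~ (5 * g)) q & last x q = y].
Proof.
rewrite {1}/fwd => /orP[/andP[/eqP-> h]|/andP[/eqP-> h]] lty.
  have [x0|[[r1 x1]|[[r1 x1]|[r2|[r3|r4]]]]] : x = 0 \/ (x %% 5 = 1 /\ x = 1) \/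
      (x %% 5 = 1 /\ 5 < x) \/ x %% 5 = 2 \/ x %% 5 = 3 \/ x %% 5 = 4 by lia.
  - by exists [:: 2; 1]; rewrite x0; split=> //=; lia.
  - by exists [:: 0; 2]; rewrite x1; split=> //=; lia.
  - by exists [:: x.-2; x.-1; x.+1]; split=> //=; rewrite /link /fwd; lia.
  - by exists [:: x.+2; x.+1]; split=> //=; rewrite /link /fwd; lia.
  - by exists [:: x.-1; x.+1]; split=> //=; rewrite /link /fwd; lia.
  - by exists [:: x.+2; x.+3; x.+1]; split=> //=; rewrite /link /fwd; lia.
have [x0|[[r0 x0]|[r2|r4]]] : x = 0 \/ (x %% 5 = 0 /\ 0 < x) \/
    x %% 5 = 2 \/ x %% 5 = 4 by lia.
- by exists [:: 1; 2]; rewrite x0; split=> //=; lia.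
- by exists [:: x.-1; x.+1; x.+2]; split=> //=; rewrite /link /fwd; lia.
- by exists [:: x.+1; x.+2]; split=> //=; rewrite /link /fwd; lia.
- by exists [:: x.+1; x.+3; x.+2]; split=> //=; rewrite /link /fwd; lia.
Qed.


Lemma remove_edge_sym (G : sgraph) (x y : G) : symmetric (remove_edge x y).
Proof. by move=> u v; rewrite /remove_edge /= adj_sym [[set v; u]]setUC. Qed.

Lemma remove_edgeC (G : sgraph) (x y : G) : remove_edge x y =2 remove_edge y x.
Proof. by move=> u v; rewrite /remove_edge /= [[set y; x]]setUC. Qed.

Lemma bridgeless_detour (G : sgraph) : connected G ->
  (forall x y : G, adj x y -> connect (remove_edge x y) x y) -> bridgeless G.
Proof.
move=> [G0 cG] det x y [xy]; apply; split=> // u v.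
apply: connect_sub (cG u v) => a b ab.
case: (boolP (remove_edge x y a b)) => [|nab]; first exact: connect1.
have {nab} : [set a; b] == [set x; y] by move: nab; rewrite /remove_edge /= ab negbK.
have := det x y xy; have := det y x; rewrite adj_sym => /(_ xy).
rewrite (eq_connect (@remove_edgeC G y x)) => yx xy' /eqP/setP E.
have := E a; have := E b; rewrite !inE !eqxx orbT /= => /esym/orP[] /eqP-> /esym/orP[] /eqP-> //.
Qed.

Lemma chain_bridgeless : bridgeless chain.
Proof.
apply: bridgeless_detour chain_connected _ => x y.
have half (a b : chain) : fwd a b -> connect (remove_edge a b) a b.
  move=> ab; have [q [pq aq lq]] := detour ab (ltn_ord b).
  apply: connect_lift pq aq lq => u v /andP[uv ne].
  apply: remove_edgeE => //.
    by move=> uE vE; move: ne; rewrite uE vE !eqxx orbT.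
  by move=> uE vE; move: ne; rewrite uE vE !eqxx.
case/orP=> [|yx]; first exact: half.
rewrite (eq_connect (@remove_edgeC chain x y)).
by rewrite (sym_connect_sym (@remove_edge_sym chain y x)); apply: half.
Qed.

(** * Domination number of the chain *)

Lemma hub_subproof (i : 'I_g) : 5 * i + 2 < 5 * g.
Proof. by have := ltn_ord i; lia. Qed.

Definition hubs : {set chain} := [set (Ordinal (hub_subproof i) : chain) | i : 'I_g].

Lemma card_hubs : #|hubs| <= g.
Proof. by rewrite -[leqRHS](card_ord g); apply: leq_imset_card. Qed.

Lemma dominating_hubs : dominating hubs.
Proof.
apply/forallP=> x; apply/implyP=> xh.
have ig : x %/ 5 < g by have := ltn_ord x; lia.
pose d : chain := Ordinal (hub_subproof (Ordinal ig)).
have dh : d \in hubs by apply: imset_f.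
apply/exists_inP; exists d => //.
have xd : x != d by apply: contraNneq xh => ->.
have {xd} : (x : nat) <> (5 * (x %/ 5) + 2)%N.
  by move=> xE; case/eqP: xd; apply: ord_inj.
by rewrite /adj /= /chain_rel /link /fwd /=; lia.
Qed.

(** The vertices b have pairwise disjoint closed neighbourhoods, told apart by [key], and [D] meets
    each of them. *)
Lemma dominating_chain_card (D : {set chain}) : dominating D -> g <= #|D|.
Proof.
move=> domD; pose key (x : chain) := x.+1 %/ 5.
have <- : size (iota 0 g) = g by rewrite size_iota.
rewrite cardE -(size_map key); apply: uniq_leq_size (iota_uniq _ _) _ => i.
rewrite mem_iota /= add0n => ig.
have bi : 5 * i < 5 * g by lia.
pose b : chain := Ordinal bi.
suff [x xD xi] : exists2 x, x \in D & key x = i.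
  by apply/mapP; exists x; rewrite ?mem_enum.
case: (boolP (b \in D)) => bD; first by exists b => //; rewrite /key /=; lia.
have /implyP/(_ bD)/exists_inP[x xD bx] := forallP domD b.
exists x => //; move: bx; rewrite /adj /= /chain_rel /link /fwd /key /=; lia.
Qed.

Lemma chain_domination_number : domination_number chain = g.
Proof.
rewrite /domination_number; case: arg_minnP => [|D domD minD].
  by apply/forallP=> x; rewrite inE.
apply/eqP; rewrite eqn_leq dominating_chain_card // andbT.
exact: leq_trans (minD _ dominating_hubs) card_hubs.
Qed.

(** * Edges forced by the cuts of the chain *)

(** Exactly two edges pass from the numbers up to [x] to the larger ones, and an edge with lower end
    [x] is one of them. *)
Lemma cut_edges x y a b c e : fwd x y -> fwd a b -> a <= x < b -> fwd c e ->
  c <= x < e -> (a, b) <> (c, e) -> (a, b) = (x, y) \/ (c, e) = (x, y).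
Proof.
rewrite /fwd => xy ab ax ce cx ne.
have {}ne : ~~ ((a == c) && (b == e)) by apply/andP=> -[/eqP ac /eqP be]; case: ne; rewrite ac be.
suff: (a == x) && (b == y) || (c == x) && (e == y).
  by case/orP=> /andP[/eqP-> /eqP->]; [left|right].
lia.
Qed.

(** Seven edges per block, listed by lower end. The last two entries of the last block would leave
    the chain; the first of these codes goes to the additional edge of block 0. *)
Definition edge_code (k : nat) : nat * nat :=
  if k == (7 * g).-2 then (0, 1) else
  (5 * (k %/ 7) + nth 0 [:: 0; 1; 2; 2; 3; 4; 4] (k %% 7),
   5 * (k %/ 7) + nth 0 [:: 2; 2; 3; 4; 4; 5; 6] (k %% 7)).

Lemma edge_code_fwd k : k < 7 * g - 1 ->
  fwd (edge_code k).1 (edge_code k).2 /\ (edge_code k).2 < 5 * g.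
Proof.
move=> kg; rewrite /edge_code; case: eqP => [_|kn] /=; first by rewrite /fwd; lia.
have := divn_eq k 7; have := ltn_pmod k (isT : 0 < 7).
set i := k %/ 7; set j := k %% 7 => j7 kE.
have {}kg : 7 * i + j < (7 * g).-2 by lia.
clear kn kE; move: i j kg j7 => i j kg.
by do 7![case: j kg => [|j] kg; first by rewrite /fwd /=; lia].
Qed.

Lemma edge_code_inj : {in gtn (7 * g - 1) &, injective edge_code}.
Proof.
move=> k k'; rewrite !inE /edge_code => kg kg'.
have := divn_eq k 7; have := ltn_pmod k (isT : 0 < 7).
have := divn_eq k' 7; have := ltn_pmod k' (isT : 0 < 7).
case: eqP => kn; case: eqP => kn'; first by move=> *; rewrite kn kn'.
- set i := k' %/ 7; set j := k' %% 7; move: i j => i j.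
  by move=> j7 _ _ _; do 7![case: j j7 => [|j] j7; first by case; lia].
- set i := k %/ 7; set j := k %% 7; move: i j => i j.
  by move=> _ _ j7 _; do 7![case: j j7 => [|j] j7; first by case; lia].
set i := k %/ 7; set j := k %% 7; set i' := k' %/ 7; set j' := k' %% 7.
move: i j i' j' => i j i' j' j7' kE' j7 kE E.
suff : (i == i') && (j == j') by case/andP=> /eqP ii /eqP jj; rewrite kE kE' ii jj.
clear kg kg' kE kE' kn kn'; move: j7 j7' E.
case: j => [|[|[|[|[|[|[|j]]]]]]] // _.
all: by case: j' => [|[|[|[|[|[|[|j']]]]]]] // _ []; lia.
Qed.

(** Strength forces an arc in each direction across every cut. In an orientation these come from
    different edges, so both edges of the cut are used. *)
Lemma chain_strong_subdigraph_card (A : {set chain * chain}) H :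
  orientation A -> strong_subdigraph A H ->
  (exists2 x : chain, x \in H.1 & x = 0 :> nat) ->
  (exists2 x : chain, x \in H.1 & x.+1 = 5 * g) ->
  7 * g - 1 <= #|H.2|.
Proof.
move=> [Aadj Aor] /andP[/andP[HA _] /forall_inP Hs] [u uH u0] [v vH vg].
have Hc (x y : chain) : x \in H.1 -> y \in H.1 -> connect (arc_rel H.2) x y.
  by move=> xH yH; apply: (forall_inP (Hs x xH)).
have used (x y : chain) : fwd x y -> ((x, y) \in H.2) || ((y, x) \in H.2).
  move=> xy; have lxy := fwd_lt xy; have ly := ltn_ord y.
  have uX : u \in [pred z : chain | z <= x] by rewrite inE u0.
  have vX : v \notin [pred z : chain | z <= x] by rewrite inE; arith.
  have [a [b [aX bX ab]]] := connect_crossing (Hc u v uH vH) uX vX.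
  have uX' : u \notin [pred z : chain | x < z] by rewrite inE u0.
  have vX' : v \in [pred z : chain | x < z] by rewrite inE; arith.
  have [e [c [eX cX ec]]] := connect_crossing (Hc v u vH uH) vX' uX'.
  have {aX bX} axb : a <= x < b by move: aX bX; rewrite !inE -ltnNge => -> ->.
  have {cX eX} cxe : c <= x < e by move: cX eX; rewrite !inE -leqNgt => -> ->.
  have abA : (a, b) \in A := subsetP HA _ ab.
  have ecA : (e, c) \in A := subsetP HA _ ec.
  have fab : fwd a b by case/orP: (Aadj _ _ abA) => // /fwd_lt; arith.
  have fce : fwd c e by case/orP: (Aadj _ _ ecA) => // /fwd_lt; arith.
  have ne : ((a : nat), (b : nat)) <> ((c : nat), (e : nat)).
    case=> /ord_inj ac /ord_inj be; have := Aor _ _ (Aadj _ _ abA).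
    by rewrite abA ac be ecA.
  case: (cut_edges xy fab axb fce cxe ne) => -[/ord_inj E1 /ord_inj E2].
    by rewrite -E1 -E2 [_ \in _]ab.
  by rewrite -E1 -E2 [(e, c) \in _]ec orbT.
(* Arcs are compared with edge codes after forgetting their direction. *)
pose norm (a : chain * chain) : nat * nat := (minn a.1 a.2, maxn a.1 a.2).
rewrite cardE -(size_map norm) -[leqLHS](size_iota 0) -(size_map edge_code).
apply: uniq_leq_size.
  rewrite map_inj_in_uniq ?iota_uniq // => k k'; rewrite !mem_iota !add0n /=.
  by move=> kg kg'; apply: edge_code_inj; rewrite inE.
move=> a /mapP[k]; rewrite mem_iota add0n /= => /edge_code_fwd[].
case: (edge_code k) => x y /= xy yg ->.
have xg : x < 5 * g := ltn_trans (fwd_lt xy) yg.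
have lxy := ltnW (fwd_lt xy).
case/orP: (used (Ordinal xg) (Ordinal yg) xy) => inH; apply/mapP.
  exists (Ordinal xg, Ordinal yg); first by rewrite mem_enum.
  by rewrite /norm /= (minn_idPl lxy) (maxn_idPr lxy).
exists (Ordinal yg, Ordinal xg); first by rewrite mem_enum.
by rewrite /norm /= (minn_idPr lxy) (maxn_idPl lxy).
Qed.

Lemma chain_sdiam_lower (A : {set chain * chain}) :
  orientation A -> strong A -> 7 * g - 1 <= sdiam A.
Proof.
move=> oA sA; pose u : chain := Ordinal chain_gt0.
have vg : (5 * g).-1 < 5 * g by rewrite prednK ?chain_gt0.
pose v : chain := Ordinal vg.
have [[H [sH uH vH sdE]] _] := sd_min u v sA.
apply: (@leq_trans (sd A u v)).
  rewrite -sdE; apply: chain_strong_subdigraph_card oA sH _ _.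
    by exists u.
  by exists v => //; rewrite /= prednK ?chain_gt0.
apply: leq_trans (leq_bigmax (F := fun u => \max_v sd A u v) u).
exact: (leq_bigmax (F := sd A u) v).
Qed.

End Chain.

Theorem theorem1p9 :
  (forall (G : sgraph) (D : {set G}) (gamma : nat),
     connected G -> bridgeless G -> dominating D -> #|D| = gamma ->
     exists k : nat, oriented_sdiam G k /\ k <= 7 * gamma - 1) /\
  (forall gamma : nat, 0 < gamma ->
     exists G : sgraph,
       [/\ connected G, bridgeless G, domination_number G = gamma
         & oriented_sdiam G (7 * gamma - 1)]).
Proof.
split=> [G D _ connG noG domD <-|g g_gt0].
  have [k kG kD] := oriented_sdiam_upper connG noG domD.
  by exists k.
have connC := chain_connected g_gt0; have noC := chain_bridgeless g_gt0.
exists (chain g); split=> //; first exact: chain_domination_number.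
have [k kG kD] := oriented_sdiam_upper connC noC (dominating_hubs g_gt0).
suff <- : k = 7 * g - 1 by [].
apply/eqP; rewrite eqn_leq; apply/andP; split.
  by apply: leq_trans kD _; rewrite leq_sub2r // leq_mul2l card_hubs.
case: kG => -[A [oA sA <-]] _; exact: chain_sdiam_lower.
Qed.
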